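(* For each $\epsilon=0,1,2$ and each $n=0,1,\dots$, the gauge Hamiltonian $\overline H_\epsilon$ leaves invariant the space $\mathcal H^n_\epsilon$ defined by $$\mathcal H^n_0=\mathcal T^n_0,\qquad \mathcal H^n_1=\mathcal T^n_1\big|_{f_N=g_N=0},\qquad \mathcal H^n_2=\mathcal T^n_2,$$ where $\mathcal T^n_1|_{f_N=g_N=0}$ denotes the span of those generators of $\mathcal T^n_1$ for which in addition $f_N=0$ and $g_N=0$.
   Context: $N\ge3$ is an integer, $\mathbf z=(z_1,\dots,z_N)$, $\partial_i=\partial/\partial z_i$, indices are cyclic ($z_{N+1}\equiv z_1$), all sums run from $1$ to $N$ unless stated otherwise; $a,b>1/2$ and $\omega$ are real parameters. $\sigma_k=\sum_i z_i^k$ and $\tau_k=\sum_{i_1<\dots<i_k}z_{i_1}\cdots z_{i_k}$. For a polynomial $f$ in (some of) the variables $\sigma_1,\sigma_2,\sigma_3,\tau_{N-1},\tau_N$: $f_k=\partial f/\partial\sigma_k$ for $k=1,2,3$, $f_k=\partial f/\partial\tau_k$ for $k=N-1,N$, and double subscripts are second derivatives. Spin space: for a fixed $M\in\frac12\mathbb N$, $\Sigma$ is the complex vector space with basis $|s_1\dots s_N\rangle$, $s_i\in\{-M,-M+1,\dots,M\}$. $S_N$ acts on $\Sigma$ by permuting spin components ($\pi$ moves the component in position $k$ to position $\pi(k)$); $S_{ij}$ is the transposition of spins $i,j$. $\Lambda$ is the projector onto states totally symmetric under simultaneous permutations of coordinates and spins (average over $S_N$). For $|s\rangle\in\Sigma$,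 $i\neq j$, $|s^{+}_{ij}\rangle=\frac1{N!}\sum_{\pi\in S_N,\,\pi(1)=i,\,\pi(2)=j}\pi(1+S_{12})|s\rangle$, and $\Sigma'=\{|s\rangle\in\Sigma:\sum_i|s^+_{i,i+1}\rangle\in\Lambda(\Sigma)\}$ (indices cyclic). Spaces: \begin{align*} \mathcal T^n_0=\big\langle & f(\sigma_1,\sigma_2,\sigma_3)\Lambda|s\rangle, g(\sigma_1,\sigma_2,\sigma_3)\Lambda(z_1|s\rangle), h(\sigma_1,\sigma_2)\Lambda(z_1^2|s\rangle),\tilde h(\sigma_1,\sigma_2)\Lambda(z_1z_2|s'\rangle),\\ & w(\sigma_1,\sigma_2)\Lambda(z_1z_2(z_1-z_2)|s\rangle)\mid f_{33}=g_{33}=0\big\rangle,\\ \mathcal T^n_1=\big\langle & f(\sigma_1,\sigma_2,\tau_N)\Lambda|s\rangle, g(\sigma_1,\tau_N)\Lambda(z_1|s\rangle)\mid f_{22}=f_{NN}=g_{NN}=0\big\rangle,\\ \mathcal T^n_2=\big\langle & f(\sigma_1,\tau_{N-1},\tau_N)\Lambda|s\rangle, g(\tau_{N-1},\tau_N)\Lambda(z_1|s\rangle),\tau_N q(\sigma_1,\tau_N)\Lambda(z_1^{-1}|s\rangle)\\ &\mid f_{11}=f_{N-1,N-1}=g_{N-1,N-1}=q_{11}=0\big\rangle, \end{align*} where $|s\rangle\in\Sigma$, $|s'\rangle\in\Sigma'$, $f,g,h,\tilde h,w,q$ are polynomials with $\deg f\le n$, $\deg g\le n-1$, $\deg h,\deg\tilde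 h\le n-2$, $\deg w\le n-3$, $\deg q\le n-N+1$ ($\deg$ = total degree in $\mathbf z$). Operators (acting on coordinates only): $K_{ij}$ exchanges $z_i$ and $z_j$; with $\vartheta_0=1$, $\vartheta_1(x,y)=\frac12(x+y)$, $\vartheta_2(x,y)=xy$, $$T_\epsilon=\sum_i z_i^\epsilon\partial_i^2+2a\sum_i\frac{z_i^\epsilon\partial_i-z_{i+1}^\epsilon\partial_{i+1}}{z_i-z_{i+1}}-2a\sum_i\frac{\vartheta_\epsilon(z_i,z_{i+1})}{(z_i-z_{i+1})^2}(1-K_{i,i+1}),$$ $J^-=\sum_i\partial_i$, $J^0=\sum_i z_i\partial_i$, and $$\overline H_0=-T_0+2\omega J^0+N\omega(2a+1),\quad \overline H_1=-4T_1-2(2b+1)J^-+4\omega J^0+N\omega(4a+2b+1),\quad \overline H_2=4T_2+4(1-2a)J^0+2Na^2.$$ *)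

(* Defs.v *)
From HB Require Import structures.
From mathcomp Require Import all_boot all_order all_fingroup all_algebra.
From mathcomp Require Import generic_quotient fraction.
From mathcomp Require Import reals.
From mathcomp Require Import complex.
From mathcomp Require Import mpoly ring.

Set Implicit Arguments.
Unset Strict Implicit.
Unset Printing Implicit Defensive.

Import Order.TTheory GRing.Theory Num.Theory.
Local Open Scope ring_scope.
Local Open Scope quotient_scope.
Local Open Scope complex_scope.

Notation polyz R N := {mpoly R[i][N]}.

Notation ratz R N := {fraction {mpoly R[i][N]}}.

(* A basis vector |s_1 ... s_N> of the spin space for spin M is a map from
   positions to 'I_(2M + 1), twoM standing for 2M; the value k of 'I_(2M + 1)
   encodes the spin component k - M.  Positions are numbered from 0. *)
Notation config N twoM := {ffun 'I_N -> 'I_(twoM.+1)}.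

Notation spinspace R N twoM := {ffun config N twoM -> R[i]^o}.

(* Spin-valued rational functions of z, by their components on the basis of
   the spin space; *: is multiplication by a scalar rational function. *)
Notation states R N twoM := {ffun config N twoM -> (ratz R N)^o}.

Section RationalFunctions.
Variables (R : realType) (N : nat).
Local Notation C := R[i].
Local Notation P := (polyz R N).
Local Notation F := (ratz R N).

Definition pol (p : P) : F := tofrac p.
Definition cst (c : C) : F := pol c%:MP.
Definition rcst (x : R) : F := cst x%:C.
Definition zcoord (i : 'I_N) : F := pol 'X_i.

(* Derivatives and permutations of the coordinates are computed on a chosen
   representative; [fderivE] and [fpermE] show that the choice is immaterial.
   [fperm s] substitutes z_(s i) for z_i. *)
Definition fderiv (i : 'I_N) (x : F) : F :=
  let r := repr x in
  pol ((\n_r)^`M(i) * \d_r - \n_r * (\d_r)^`M(i)) / pol (\d_r) ^+ 2.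

Definition fperm (s : 'S_N) (x : F) : F :=
  let r := repr x in pol (msym s \n_r) / pol (msym s \d_r).

Lemma repr_frac (p q : P) : q != 0 ->
  let r := repr (pol p / pol q) in \n_r * q = p * \d_r.
Proof.
move=> q0 r.
have dr0 : \d_r != 0 by exact: denom_ratioP.
have e : pol \n_r / pol \d_r = pol p / pol q.
  suff <- : \pi_(F) r = pol \n_r / pol \d_r by rewrite reprK.
  apply: (canRL (mulfK _)); first by rewrite tofrac_eq0.
  rewrite /pol !piE; apply/eqmodP; rewrite /= FracField.equivfE /FracField.mulf.
  by rewrite !numden_Ratio ?mulr1 ?oner_neq0 // mulrC.
apply/eqP; rewrite -tofrac_eq !tofracM -[_ == _]/(pol _ * pol _ == pol _ * pol _).
by rewrite -eqr_div ?tofrac_eq0 //; apply/eqP.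
Qed.

Lemma pol_eq_div (p q r s : P) : q != 0 -> s != 0 -> p * s = r * q ->
  pol p / pol q = pol r / pol s.
Proof.
move=> q0 s0 e; apply/eqP; rewrite eqr_div ?tofrac_eq0 //.
by have /eqP := congr1 (@pol) e; rewrite /pol !tofracM.
Qed.

Lemma fderivE i (p q : P) : q != 0 ->
  fderiv i (pol p / pol q) = pol (p^`M(i) * q - p * q^`M(i)) / pol q ^+ 2.
Proof.
move=> q0; rewrite /fderiv; set r := repr _.
have d0 : \d_r != 0 by exact: denom_ratioP.
have e : \n_r * q = p * \d_r by exact: repr_frac.
have e' : (\n_r)^`M(i) * q + \n_r * q^`M(i) = p^`M(i) * \d_r + p * (\d_r)^`M(i).
  by rewrite -!mderivM e.
have polX2 (u : P) : pol u ^+ 2 = pol (u ^+ 2) by rewrite /pol tofracXn.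
rewrite !polX2.
apply: (pol_eq_div (expf_neq0 2 d0) (expf_neq0 2 q0)).
move: e e'; move: (\n_r) (\d_r) => n d.
move: (n^`M(i)) (d^`M(i)) (p^`M(i)) (q^`M(i)) => n' d' p' q' e e'.
have -> : (n' * d - n * d') * q ^+ 2
   = d * q * (n' * q + n * q') - (n * q) * (d * q' + d' * q) by ring.
by rewrite e e'; ring.
Qed.

Lemma fpermE s (p q : P) : q != 0 ->
  fperm s (pol p / pol q) = pol (msym s p) / pol (msym s q).
Proof.
move=> q0; rewrite /fperm; set r := repr _.
have e : \n_r * q = p * \d_r by exact: repr_frac.
have ms0 (u : P) : u != 0 -> msym s u != 0.
  apply: contraNneq => su0; apply/eqP/mpolyP => m.
  have := mcoeff_sym u s [multinom m ((s^-1)%g i) | i < N].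
  rewrite su0 !mcoeff0 => ->; congr mcoeff; apply/mnmP => i.
  by rewrite !mnmE permK.
apply: (pol_eq_div (ms0 _ (denom_ratioP r)) (ms0 _ q0)).
by have := congr1 (msym s) e; rewrite !msymM.
Qed.

Definition theta (eps : nat) (x y : F) : F :=
  match eps with 0 => 1 | 1 => (x + y) / 2 | _ => x * y end.

Definition Top (eps : nat) (a : R) (x : F) : F :=
  (\sum_i zcoord i ^+ eps * fderiv i (fderiv i x))
  + rcst (2 * a) * (\sum_i
      (zcoord i ^+ eps * fderiv i x
       - zcoord (ordS i) ^+ eps * fderiv (ordS i) x)
      / (zcoord i - zcoord (ordS i)))
  - rcst (2 * a) * (\sum_i
      theta eps (zcoord i) (zcoord (ordS i)) / (zcoord i - zcoord (ordS i)) ^+ 2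
      * (x - fperm (tperm i (ordS i)) x)).

Definition Jminus (x : F) : F := \sum_i fderiv i x.
Definition Jzero (x : F) : F := \sum_i zcoord i * fderiv i x.

Definition Hbar0 (a omega : R) (x : F) : F :=
  - Top 0 a x + rcst (2 * omega) * Jzero x
  + rcst (N%:R * omega * (2 * a + 1)) * x.

Definition Hbar1 (a b omega : R) (x : F) : F :=
  - (rcst 4 * Top 1 a x) - rcst (2 * (2 * b + 1)) * Jminus x
  + rcst (4 * omega) * Jzero x
  + rcst (N%:R * omega * (4 * a + 2 * b + 1)) * x.

Definition Hbar2 (a : R) (x : F) : F :=
  rcst 4 * Top 2 a x + rcst (4 * (1 - 2 * a)) * Jzero x
  + rcst (2 * N%:R * a ^+ 2) * x.

Definition sigma (k : nat) : P := \sum_i 'X_i ^+ k.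
Definition tau (k : nat) : P := mesym N C k.

(* msize is 1 + total degree and vanishes only at 0, so a negative bound d
   allows only p = 0. *)
Definition deg_le (p : P) (d : int) : Prop := (msize p)%:Z <= d + 1.

End RationalFunctions.

Section SpinStates.
Variables (R : realType) (N : nat) (hN : (2 < N)%N) (twoM : nat).
Local Notation C := R[i].
Local Notation F := (ratz R N).
Local Notation spins := (spinspace R N twoM).
Local Notation state := (states R N twoM).

Definition pos1 : 'I_N := Ordinal (ltnW (ltnW hN)).
Definition pos2 : 'I_N := Ordinal (ltnW hN).

(* s moves the component in position k to position s k, i.e. sends |c o s> to
   |c>; hence the amplitude of s|v> on |c> is that of |v> on |c o s>. *)
Definition spin_act (A : Type) (s : 'S_N) (v : {ffun config N twoM -> A}) :
    {ffun config N twoM -> A} :=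
  [ffun c : config N twoM => v [ffun k => c (s k)]].

Definition on_states (O : F -> F) (psi : state) : state :=
  [ffun c => O (psi c)].

Definition total_act (s : 'S_N) (psi : state) : state :=
  spin_act s (on_states (fperm s) psi).

Definition Lambda (psi : state) : state :=
  (N`!%:R : F)^-1 *: \sum_(s : 'S_N) total_act s psi.

Definition ket (v : spins) : state := [ffun c => cst N (v c)].

Definition splus (i j : 'I_N) (v : spins) : spins :=
  (N`!%:R : C)^-1 *: \sum_(s : 'S_N | (s pos1 == i) && (s pos2 == j))
                        spin_act s (v + spin_act (tperm pos1 pos2) v).

Definition in_Sigma' (v : spins) : Prop :=
  exists t : spins, ket (\sum_i splus i (ordS i) v) = Lambda (ket t).

Definition cspan (G : state -> Prop) (psi : state) : Prop :=
  exists (k : nat) (c : 'I_k -> C) (phi : 'I_k -> state),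
    (forall i, G (phi i)) /\ psi = \sum_(i < k) cst N (c i) *: phi i.

Definition leaves_invariant (O : state -> state) (S : state -> Prop) : Prop :=
  forall psi, S psi -> S (O psi).

Let z1 : F := zcoord R pos1.
Let z2 : F := zcoord R pos2.

Notation sg := (sigma R N).
Notation ta := (tau R N).

(* In each generator, f, g, h, ... are polynomials in formal variables, the
   j-th variable (counted from 0) standing for the j-th entry of the tuple
   that is substituted; [d1], [d2], [d3] are the partial derivatives with
   respect to the first, second and third of these variables. *)
Definition d1 m (p : {mpoly C[m.+1]}) : {mpoly C[m.+1]} := p^`M(@Ordinal m.+1 0 isT).
Definition d2 m (p : {mpoly C[m.+2]}) : {mpoly C[m.+2]} := p^`M(@Ordinal m.+2 1 isT).
Definition d3 m (p : {mpoly C[m.+3]}) : {mpoly C[m.+3]} := p^`M(@Ordinal m.+3 2 isT).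

Inductive T0_gen (n : nat) : state -> Prop :=
| T0_f (f : {mpoly C[3]}) (v : spins) :
    let p := f \mPo [tuple sg 1; sg 2; sg 3] in
    d3 (d3 f) = 0 -> deg_le p n%:Z ->
    T0_gen n (pol p *: Lambda (ket v))
| T0_g (g : {mpoly C[3]}) (v : spins) :
    let p := g \mPo [tuple sg 1; sg 2; sg 3] in
    d3 (d3 g) = 0 -> deg_le p (n%:Z - 1) ->
    T0_gen n (pol p *: Lambda (z1 *: ket v))
| T0_h (h : {mpoly C[2]}) (v : spins) :
    let p := h \mPo [tuple sg 1; sg 2] in
    deg_le p (n%:Z - 2) ->
    T0_gen n (pol p *: Lambda (z1 ^+ 2 *: ket v))
| T0_ht (ht : {mpoly C[2]}) (v : spins) :
    let p := ht \mPo [tuple sg 1; sg 2] in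
    in_Sigma' v -> deg_le p (n%:Z - 2) ->
    T0_gen n (pol p *: Lambda ((z1 * z2) *: ket v))
| T0_w (w : {mpoly C[2]}) (v : spins) :
    let p := w \mPo [tuple sg 1; sg 2] in
    deg_le p (n%:Z - 3) ->
    T0_gen n (pol p *: Lambda ((z1 * z2 * (z1 - z2)) *: ket v)).

(* The generators of T_1^n with the extra conditions f_N = 0 and g_N = 0. *)
Inductive T1_restr_gen (n : nat) : state -> Prop :=
| T1_f (f : {mpoly C[3]}) (v : spins) :
    let p := f \mPo [tuple sg 1; sg 2; ta N] in
    d2 (d2 f) = 0 -> d3 (d3 f) = 0 -> d3 f = 0 -> deg_le p n%:Z ->
    T1_restr_gen n (pol p *: Lambda (ket v))
| T1_g (g : {mpoly C[2]}) (v : spins) :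
    let p := g \mPo [tuple sg 1; ta N] in
    d2 (d2 g) = 0 -> d2 g = 0 -> deg_le p (n%:Z - 1) ->
    T1_restr_gen n (pol p *: Lambda (z1 *: ket v)).

Inductive T2_gen (n : nat) : state -> Prop :=
| T2_f (f : {mpoly C[3]}) (v : spins) :
    let p := f \mPo [tuple sg 1; ta N.-1; ta N] in
    d1 (d1 f) = 0 -> d2 (d2 f) = 0 -> deg_le p n%:Z ->
    T2_gen n (pol p *: Lambda (ket v))
| T2_g (g : {mpoly C[2]}) (v : spins) :
    let p := g \mPo [tuple ta N.-1; ta N] in
    d1 (d1 g) = 0 -> deg_le p (n%:Z - 1) ->
    T2_gen n (pol p *: Lambda (z1 *: ket v))
| T2_q (q : {mpoly C[2]}) (v : spins) :
    let p := q \mPo [tuple sg 1; ta N] in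
    d1 (d1 q) = 0 -> deg_le p (n%:Z - N%:Z + 1) ->
    T2_gen n ((pol (ta N) * pol p) *: Lambda (z1^-1 *: ket v)).

Definition H0space (n : nat) : state -> Prop := cspan (T0_gen n).
Definition H1space (n : nat) : state -> Prop := cspan (T1_restr_gen n).
Definition H2space (n : nat) : state -> Prop := cspan (T2_gen n).

End SpinStates.

(* Main.v *)
From HB Require Import structures.
Require Import Defs.
From mathcomp Require Import all_boot all_order all_fingroup all_algebra.
From mathcomp Require Import generic_quotient fraction.
From mathcomp Require Import reals.
From mathcomp Require Import complex.
From mathcomp Require Import mpoly ring zify.

(** For a symmetric x, the second-order operator T_eps satisfies
    T(x y) = x T(y) + T(x) y + 2 Gamma(x, y), where
    Gamma(x, y) = sum_i z_i^eps (d_i x) (d_i y) is a derivation in each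
    argument.  The sums of cyclic neighbour terms are elementary on sigma_k,
    tau_(N-1), tau_N and on the few coordinate parts (z_k, z_k^2, z_j z_k, ...)
    that occur, so the action of T_eps on every product of these is explicit,
    and each result is visibly a combination of such products within the degree
    bound.  Only T_0(z_j z_k), which is supported on neighbouring positions,
    leaves the pattern; the condition defining Sigma' says exactly that the
    neighbouring terms add up to a symmetric state.
    A generator f(sigma, tau) Lambda(...) reduces to monomials: grading f by
    weight, the components heavier than deg f(sigma, tau) compose to 0, so they
    can be dropped without appeal to algebraic independence. *)

Set Implicit Arguments.
Unset Strict Implicit.
Unset Printing Implicit Defensive.

Import Order.TTheory GRing.Theory Num.Theory.
Local Open Scope ring_scope.
Local Open Scope quotient_scope.
Local Open Scope complex_scope.

(** * The operators in an abstract differential field *)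

(** The linearity conditions on f, g, q single out the factors whose Gamma with themselves produces
    symmetric functions outside the list of variables: Gamma_0(sigma_3, sigma_3) = 9 sigma_4,
    Gamma_1(sigma_2, sigma_2) = 4 sigma_3, Gamma_2(sigma_1, sigma_1) = sigma_2, while
    Gamma_2(tau_(N-1), tau_(N-1)) involves tau_(N-2). The condition f_N = 0 for eps = 1 answers to
    J^- tau_N = tau_(N-1). The remaining variables occur to any power, because Gamma against them is
    a J operator: J^- and 2 J^0 for sigma_1, sigma_2 (eps = 0), J^0 for sigma_1 (eps = 1), tau_N J^0
    for tau_N (eps = 2). Hence every product splits into a monomial in these and a factor Phi from a
    short list, and only T_eps Phi, J^- Phi and the Euler eigenvalue of Phi have to be known. These
    computations use nothing but the Leibniz rule and the values of derivations and permutations on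
    the coordinates, so they take place over any field with such data, where no representative of a
    fraction appears. *)

Record calculus (K : fieldType) (N : nat) := Calculus {
  der : 'I_N -> {additive K -> K};
  act : 'S_N -> {rmorphism K -> K};
  zvar : 'I_N -> K;
  derM : forall i x y, der i (x * y) = der i x * y + x * der i y;
  der_zvar : forall i j, der i (zvar j) = (i == j)%:R;
  act_zvar : forall s j, act s (zvar j) = zvar (s j);
  zvar_inj : injective zvar;
  zvar_neq0 : forall i, zvar i != 0;
  two_neq0 : 2 != 0 :> K;
  gt2 : (2 < N)%N
}.

Section DifferenceDifferential.
Variables (K : fieldType) (N : nat) (X : calculus K N).
Local Notation D := (der X).
Local Notation P := (act X).
Local Notation z := (zvar X).
Local Notation DM := (derM X).
Local Notation Dz := (der_zvar X).
Local Notation Pz := (act_zvar X).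
Local Notation hN := (gt2 X).
Local Notation z_neq0 := (zvar_neq0 X).

Local Notation nx := (@ordS N).
Local Notation swap i := (tperm i (nx i)).

Definition vartheta (eps : nat) (x y : K) : K :=
  match eps with 0 => 1 | 1 => (x + y) / 2 | _ => x * y end.

(** The derivative and exchange terms of a neighbour pair are kept together: on a non-symmetric
    coordinate part each alone has a pole at z_i = z_(i+1), and the poles cancel in the
    difference. *)
Definition pair_op eps (x : K) (i : 'I_N) : K :=
  (z i ^+ eps * D i x - z (nx i) ^+ eps * D (nx i) x) / (z i - z (nx i))
  - vartheta eps (z i) (z (nx i)) / (z i - z (nx i)) ^+ 2 * (x - P (swap i) x).

(* [A] stands for the coupling 2a. *)
Definition top eps (A : K) (x : K) : K :=
  (\sum_i z i ^+ eps * D i (D i x)) + A * (\sum_i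
      (z i ^+ eps * D i x - z (nx i) ^+ eps * D (nx i) x)
      / (z i - z (nx i)))
  - A * (\sum_i vartheta eps (z i) (z (nx i)) / (z i - z (nx i)) ^+ 2
      * (x - P (swap i) x)).

Definition Jm (x : K) : K := \sum_i D i x.
Definition J0 (x : K) : K := \sum_i z i * D i x.
Definition Jp (x : K) : K := \sum_i z i ^+ 2 * D i x.
Definition Gam eps (x y : K) : K := \sum_i z i ^+ eps * D i x * D i y.

Definition symm (x : K) : Prop := forall s, P s x = x.
(** Stand-in for the complex scalars, since K carries no distinguished scalar field here;
    [isconst_cst] supplies the instances. *)
Definition isconst (x : K) : Prop := (forall i, D i x = 0) /\ symm x.

(** * Additivity and product rules *)

Lemma topE eps A x :
  top eps A x = (\sum_i z i ^+ eps * D i (D i x)) + A * \sum_i pair_op eps x i.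
Proof. by rewrite /top -addrA -mulrBr -sumrB. Qed.

Lemma nx_neq i : nx i != i.
Proof.
apply/eqP => /(congr1 val) /=; have := ltn_ord i; have := hN => n2 h.
case: (ltnP i.+1 N) => h1; first by rewrite modn_small //; lia.
have -> : i.+1 = N by lia.
rewrite modnn; lia.
Qed.

Lemma zB_neq0 i j : i != j -> z i - z j != 0.
Proof. by apply: contra; rewrite subr_eq0 => /eqP/zvar_inj ->. Qed.

Lemma D1 i : D i 1 = 0.
Proof. by have /eqP := DM i 1 1;
  rewrite !mulr1 mul1r eq_sym addrC -subr_eq0 addrK => /eqP. Qed.

Lemma DX i x n : D i (x ^+ n) = n%:R * x ^+ n.-1 * D i x.
Proof.
elim: n => [|n IH]; first by rewrite expr0 D1 !mul0r.
rewrite exprS DM IH /=; case: n {IH} => [|n] /=; first by rewrite expr0; ring.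
by rewrite -[in RHS]natr1 exprS; ring.
Qed.

Lemma DV i x : x != 0 -> D i x^-1 = - D i x / x ^+ 2.
Proof.
move=> x0; have := D1 i; rewrite -(mulfV x0) DM => /eqP.
rewrite addrC addr_eq0 => /eqP e; apply: (mulfI x0); rewrite e; field.
exact: x0.
Qed.

Lemma Dnat i n : D i n%:R = 0.
Proof. by rewrite -[n%:R]/(1 *+ n) raddfMn /= D1 mul0rn. Qed.

Lemma J0M x y : J0 (x * y) = J0 x * y + x * J0 y.
Proof.
rewrite /J0 mulr_suml mulr_sumr -big_split; apply: eq_bigr => i _ /=.
by rewrite DM; ring.
Qed.

Lemma JmM x y : Jm (x * y) = Jm x * y + x * Jm y.
Proof.
by rewrite /Jm mulr_suml mulr_sumr -big_split; apply: eq_bigr => i _ /=; rewrite DM.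
Qed.

Lemma GamMl eps x x' y : Gam eps (x * x') y = Gam eps x y * x' + x * Gam eps x' y.
Proof.
rewrite /Gam mulr_suml mulr_sumr -big_split; apply: eq_bigr => i _ /=.
by rewrite DM; ring.
Qed.

Lemma GamC eps x y : Gam eps x y = Gam eps y x.
Proof. by apply: eq_bigr => i _; ring. Qed.

Lemma GamXl eps x n y : Gam eps (x ^+ n) y = n%:R * x ^+ n.-1 * Gam eps x y.
Proof.
by rewrite /Gam mulr_sumr; apply: eq_bigr => i _; rewrite DX; ring.
Qed.

Lemma topD eps A x y : top eps A (x + y) = top eps A x + top eps A y.
Proof.
rewrite !topE addrACA -mulrDr -!big_split; congr (_ + _ * _); apply: eq_bigr => i _ /=.
  by rewrite !raddfD; ring.
by rewrite /pair_op !raddfD /=; ring.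
Qed.

Lemma J0D x y : J0 (x + y) = J0 x + J0 y.
Proof. by rewrite /J0 -big_split; apply: eq_bigr => i _ /=; rewrite raddfD mulrDr. Qed.

Lemma JmD x y : Jm (x + y) = Jm x + Jm y.
Proof. by rewrite /Jm -big_split; apply: eq_bigr => i _ /=; rewrite raddfD. Qed.

(** K_(i,i+1) passes through the symmetric factor, so the neighbour terms obey a plain Leibniz rule;
    the cross term comes from the second derivatives alone. *)
Lemma topM eps A x y : symm x ->
  top eps A (x * y) = x * top eps A y + top eps A x * y + 2 * Gam eps x y.
Proof.
move=> sx; rewrite !topE.
have -> : \sum_i pair_op eps (x * y) i =
    x * \sum_i pair_op eps y i + (\sum_i pair_op eps x i) * y.
  rewrite mulr_sumr mulr_suml -big_split; apply: eq_bigr => i _ /=.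
  by rewrite /pair_op !DM rmorphM /= sx; ring.
have -> : \sum_i z i ^+ eps * D i (D i (x * y)) =
    x * (\sum_i z i ^+ eps * D i (D i y)) + (\sum_i z i ^+ eps * D i (D i x)) * y
      + 2 * Gam eps x y.
  rewrite /Gam !mulr_sumr mulr_suml -!big_split; apply: eq_bigr => i _ /=.
  by rewrite DM raddfD /= !DM; ring.
ring.
Qed.

Lemma top1 eps A : top eps A 1 = 0.
Proof.
rewrite topE !big1 ?mulr0 ?addr0 // => i _;
  rewrite ?/pair_op ?rmorph1 !D1 ?raddf0 ?mulr0 //.
by rewrite !subrr mul0r mulr0 subr0.
Qed.

Lemma topX eps A x n : symm x ->
  top eps A (x ^+ n) = n%:R * x ^+ n.-1 * top eps A x
    + n%:R * n.-1%:R * x ^+ n.-2 * Gam eps x x.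
Proof.
move=> sx; elim: n => [|n IH]; first by rewrite expr0 top1; ring.
rewrite exprS topM // IH GamC GamXl /=.
case: n {IH} => [|[|n]] /=; first by rewrite !expr0; ring.
  by rewrite expr1 expr0; ring.
by rewrite -!(natr1 n.+1) -!(natr1 n) !exprS; ring.
Qed.

Lemma topMc eps A k x : isconst k -> top eps A (k * x) = k * top eps A x.
Proof.
case=> Dk sk; rewrite topM // [Gam _ _ _]big1 => [|i _]; last by rewrite Dk mulr0 mul0r.
suff -> : top eps A k = 0 by rewrite mul0r mulr0 !addr0.
rewrite topE !big1 ?mulr0 ?addr0 // => i _; last by rewrite Dk raddf0 mulr0.
by rewrite /pair_op sk !Dk !mulr0 !subrr mul0r mulr0 subr0.
Qed.

Lemma J0Mc k x : isconst k -> J0 (k * x) = k * J0 x.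
Proof. by case=> Dk _; rewrite J0M [J0 k]big1 ?mul0r ?add0r // => i _;
  rewrite Dk mulr0. Qed.

Lemma JmMc k x : isconst k -> Jm (k * x) = k * Jm x.
Proof. by case=> Dk _; rewrite JmM [Jm k]big1 ?mul0r ?add0r // => i _; rewrite Dk. Qed.

(** * Power sums, tau_N and tau_(N-1) *)

Definition ps k : K := \sum_i z i ^+ k.
Definition tN : K := \prod_i z i.
(** This is tau_(N-1), written so that its derivatives follow from those of tau_N and of the inverse
    coordinates; [pol_tauN1] identifies it with the elementary symmetric polynomial. *)
Definition tN1 : K := tN * \sum_i (z i)^-1.

Lemma symm_ps k : symm (ps k).
Proof.
move=> s; rewrite /ps rmorph_sum [RHS](reindex_inj (@perm_inj _ s)) /=.
by apply: eq_bigr => i _; rewrite rmorphXn /= Pz.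
Qed.

Lemma symm_tN : symm tN.
Proof.
move=> s; rewrite /tN rmorph_prod [RHS](reindex_inj (@perm_inj _ s)) /=.
by apply: eq_bigr => i _; rewrite Pz.
Qed.

Lemma symm_tN1 : symm tN1.
Proof.
move=> s; rewrite /tN1 rmorphM /= symm_tN rmorph_sum; congr (_ * _).
rewrite [RHS](reindex_inj (@perm_inj _ s)) /=.
by apply: eq_bigr => i _; rewrite fmorphV Pz.
Qed.

Lemma symmM x y : symm x -> symm y -> symm (x * y).
Proof. by move=> sx sy s; rewrite rmorphM /= sx sy. Qed.

Lemma symmX x n : symm x -> symm (x ^+ n).
Proof. by move=> sx s; rewrite rmorphXn /= sx. Qed.

Lemma sum_delta (f : 'I_N -> K) j : \sum_i f i * (i == j)%:R = f j.
Proof.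
rewrite (bigD1 j) //= eqxx mulr1 big1 ?addr0 // => i /negPf ->.
by rewrite mulr0.
Qed.

Lemma sum_delta1 (j : 'I_N) : \sum_i (i == j)%:R = 1 :> K.
Proof. by rewrite -[RHS](sum_delta (fun=> 1) j); apply: eq_bigr => i _; rewrite mul1r. Qed.

Lemma sum_nx (f : 'I_N -> K) : \sum_i f (nx i) = \sum_i f i.
Proof. by apply/esym/(reindex_inj (@ordS_inj N)). Qed.

Lemma D_ps i k : D i (ps k) = k%:R * z i ^+ k.-1.
Proof.
rewrite /ps raddf_sum -(sum_delta (fun i => k%:R * z i ^+ k.-1) i).
apply: eq_bigr => j _; rewrite /= DX Dz eq_sym; case: eqVneq => // _; by rewrite !mulr0.
Qed.

Lemma D_Vz i j : D i (z j)^-1 = - (i == j)%:R / z j ^+ 2.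
Proof. by rewrite DV ?z_neq0 // Dz. Qed.

Lemma D_tN i : D i tN = tN / z i.
Proof.
rewrite /tN (bigD1 i) //= DM Dz eqxx mul1r.
have -> : D i (\prod_(j | j != i) z j) = 0.
  apply: (big_ind (fun x => D i x = 0)) => [|x y hx hy|j ji]; first exact: D1.
    by rewrite DM hx hy mul0r mulr0 addr0.
  by rewrite Dz eq_sym (negPf ji).
by rewrite mulr0 addr0 mulrC mulKf ?z_neq0.
Qed.

Lemma D_tN1 i : D i tN1 = tN1 / z i - tN / z i ^+ 2.
Proof.
rewrite /tN1 DM D_tN raddf_sum /=.
have -> : \sum_j D i (z j)^-1 = - (z i)^-1 ^+ 2.
  rewrite -(sum_delta (fun i => - (z i)^-1 ^+ 2) i); apply: eq_bigr => j _.
  by rewrite D_Vz eq_sym; case: eqVneq => [->|_] /=;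
    rewrite ?mulr0 ?oppr0 ?mul0r // mulr1 mulN1r exprVn.
by rewrite exprVn; ring.
Qed.

Lemma sum1 : \sum_(i < N) (1 : K) = N%:R.
Proof. by rewrite sumr_const card_ord. Qed.

(** * Neighbour terms on coordinate parts, and the values of T_eps *)

Lemma pair_op_symm eps x i : symm x ->
  pair_op eps x i =
    (z i ^+ eps * D i x - z (nx i) ^+ eps * D (nx i) x) / (z i - z (nx i)).
Proof. by move=> sx; rewrite /pair_op sx subrr mulr0 subr0. Qed.

Lemma zB_nx i : z i - z (nx i) != 0.
Proof. by apply: zB_neq0; rewrite eq_sym nx_neq. Qed.

(** Incidence of the position k with the neighbour pair (i, i+1). Each position lies on two such
    pairs, which is the origin of the factors 2A below. *)
Definition adj i k : K := (i == k)%:R + (nx i == k)%:R.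

Lemma sum_adj k : \sum_i adj i k = 2.
Proof.
by rewrite /adj big_split /= (sum_nx (fun i => (i == k)%:R)) sum_delta1 -[2]/(1 + 1).
Qed.

Lemma pair0_z k i : pair_op 0 (z k) i = 0.
Proof.
have xy := zB_nx i; rewrite /pair_op Pz !Dz /=.
case: tpermP => [->|->|/eqP ki /eqP kn].
- by rewrite eqxx (negPf (nx_neq i)) /=; field.
- by rewrite eqxx eq_sym (negPf (nx_neq i)) /=; field.
- by rewrite !(eq_sym _ k) (negPf ki) (negPf kn) /=; field.
Qed.

Lemma pair1_z k i : pair_op 1 (z k) i = adj i k / 2.
Proof.
have xy := zB_nx i; have t0 := two_neq0 X; rewrite /pair_op /adj Pz !Dz /=.
case: tpermP => [->|->|/eqP ki /eqP kn].
- by rewrite eqxx (negPf (nx_neq i)) /=; field; rewrite t0.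
- by rewrite eqxx eq_sym (negPf (nx_neq i)) /=; field; rewrite t0.
- by rewrite !(eq_sym _ k) (negPf ki) (negPf kn) /=; field; rewrite t0.
Qed.

Lemma pair2_z k i : pair_op 2 (z k) i = adj i k * z k.
Proof.
have xy := zB_nx i; rewrite /pair_op /adj Pz !Dz /=.
case: tpermP => [->|->|/eqP ki /eqP kn].
- by rewrite eqxx (negPf (nx_neq i)) /=; field.
- by rewrite eqxx eq_sym (negPf (nx_neq i)) /=; field.
- by rewrite !(eq_sym _ k) (negPf ki) (negPf kn) /=; field.
Qed.

Lemma pair2_Vz k i : pair_op 2 (z k)^-1 i = 0.
Proof.
have xy := zB_nx i; rewrite /pair_op fmorphV Pz !D_Vz /=.
have := z_neq0 i; have := z_neq0 (nx i); have := z_neq0 k.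
case: tpermP => [->|->|/eqP ki /eqP kn] k0 j0 i0.
- by rewrite eqxx (negPf (nx_neq i)) /=; field; rewrite xy i0 j0.
- by rewrite eqxx eq_sym (negPf (nx_neq i)) /=; field; rewrite xy i0 j0.
- by rewrite !(eq_sym _ k) (negPf ki) (negPf kn) /=; field; rewrite xy k0.
Qed.

Lemma pair0_z2 k i : pair_op 0 (z k ^+ 2) i = adj i k.
Proof.
have xy := zB_nx i; rewrite /pair_op /adj rmorphXn /= Pz !DX !Dz /=.
case: tpermP => [->|->|/eqP ki /eqP kn].
- by rewrite eqxx (negPf (nx_neq i)) /=; field.
- by rewrite eqxx eq_sym (negPf (nx_neq i)) /=; field.
- by rewrite !(eq_sym _ k) (negPf ki) (negPf kn) /=; field.
Qed.

(** A pair meeting only one of j, k gives 0, by [pair0_z]. On the pair {j, k} itself the exchange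
    acts trivially and the derivative term is (z_k - z_j) / (z_j - z_k) = -1, so the result depends
    on adjacency. *)
Lemma pair0_zz j k i : j != k -> pair_op 0 (z j * z k) i =
  - ((nx i == k)%:R * (i == j)%:R + (nx i == j)%:R * (i == k)%:R).
Proof.
have xy := zB_nx i; rewrite /pair_op rmorphM /= !Pz !DM !Dz /=.
case: tpermP => [->|->|/eqP ji /eqP jn] jk;
  case: tpermP jk => [->|->|/eqP ki /eqP kn]; rewrite ?eqxx // => jk;
  rewrite ?(negPf (nx_neq i)) ?[i == nx i]eq_sym ?(negPf (nx_neq i))
    ?(eq_sym _ k) ?(eq_sym _ j)
   ?(negPf ki) ?(negPf kn) ?(negPf ji) ?(negPf jn) ?eqxx /=; by field.
Qed.

(** A pair meeting only j gives z_k, one meeting only k gives - z_j. Thanks to the antisymmetric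
    factor the pair {j, k} gives exactly the sum of the two, so that no trace of adjacency survives
    in the total. *)
Lemma pair0_w j k i : j != k -> pair_op 0 (z j * z k * (z j - z k)) i =
  adj i j * z k - adj i k * z j.
Proof.
have xy := zB_nx i; rewrite /pair_op /adj !rmorphM rmorphB /= !Pz !DM !raddfB /= !Dz /=.
case: tpermP => [->|->|/eqP ji /eqP jn] jk;
  case: tpermP jk => [->|->|/eqP ki /eqP kn]; rewrite ?eqxx // => jk;
  rewrite ?(negPf (nx_neq i)) ?[i == nx i]eq_sym ?(negPf (nx_neq i))
    ?(eq_sym _ k) ?(eq_sym _ j)
   ?(negPf ki) ?(negPf kn) ?(negPf ji) ?(negPf jn) ?eqxx /=; by field.
Qed.

Lemma top0_z A k : top 0 A (z k) = 0.
Proof.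
rewrite topE !big1 ?mulr0 ?addr0 // => i _; first by rewrite pair0_z.
by rewrite Dz Dnat mulr0.
Qed.

Lemma top1_z A k : top 1 A (z k) = A.
Proof.
rewrite topE big1 ?add0r => [|i _]; last by rewrite Dz Dnat mulr0.
rewrite (eq_bigr (fun i => adj i k / 2)) => [|i _]; last exact: pair1_z.
by rewrite -mulr_suml sum_adj mulfV ?mulr1 // (two_neq0 X).
Qed.

Lemma top2_z A k : top 2 A (z k) = 2 * A * z k.
Proof.
rewrite topE big1 ?add0r => [|i _]; last by rewrite Dz Dnat mulr0.
rewrite (eq_bigr (fun i => adj i k * z k)) => [|i _]; last exact: pair2_z.
by rewrite -mulr_suml sum_adj; ring.
Qed.

Lemma top2_Vz A k : top 2 A (z k)^-1 = 2 / z k.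
Proof.
have k0 := z_neq0 k.
rewrite topE [X in A * X]big1 ?mulr0 ?addr0 => [|i _]; last exact: pair2_Vz.
rewrite -(sum_delta (fun i => 2 / z i) k); apply: eq_bigr => i _.
rewrite D_Vz DM raddfN /= Dnat oppr0 mul0r add0r -exprVn DX D_Vz /=.
have i0 := z_neq0 i; case: eqVneq => [->|_] /=; first by field.
by rewrite !oppr0 !mul0r !mulr0.
Qed.

Lemma top0_z2 A k : top 0 A (z k ^+ 2) = 2 + 2 * A.
Proof.
rewrite topE (eq_bigr (fun i => 2 * (i == k)%:R)) => [|i _]; last first.
  rewrite DX Dz !DM Dz !Dnat /=; case: eqVneq => _ /=; ring.
rewrite sum_delta (eq_bigr (fun i => adj i k)) => [|i _]; last exact: pair0_z2.
by rewrite sum_adj; ring.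
Qed.

Lemma top0_zz A j k : j != k ->
  top 0 A (z j * z k) = - A * ((nx j == k)%:R + (nx k == j)%:R).
Proof.
move=> jk; rewrite topE big1 => [|i _]; last first.
  rewrite DM raddfD /= !DM !Dz !Dnat; case: eqVneq => [ij|_] /=; last by ring.
  by rewrite ij (negPf jk) /=; ring.
rewrite (eq_bigr _ (fun i _ => pair0_zz i jk)) sumrN big_split /=.
by rewrite (sum_delta (fun i => (nx i == k)%:R)) (sum_delta (fun i => (nx i == j)%:R)); ring.
Qed.

Lemma top0_w A j k : j != k ->
  top 0 A (z j * z k * (z j - z k)) = (2 + 2 * A) * (z k - z j).
Proof.
move=> jk; rewrite topE.
rewrite (eq_bigr (fun i => 2 * z k * (i == j)%:R - 2 * z j * (i == k)%:R)) => [|i _];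
  last first.
  rewrite !(DM, raddfD, raddfN, Dz, Dnat) /=; case: eqVneq => [ij|_] /=.
    by rewrite ij (negPf jk) /=; ring.
  by case: eqVneq => _ /=; ring.
rewrite (eq_bigr _ (fun i _ => pair0_w i jk)) !sumrB -!mulr_suml !sum_adj !sum_delta.
ring.
Qed.

Lemma top0_ps1 A : top 0 A (ps 1) = 0.
Proof.
rewrite topE !big1 ?mulr0 ?addr0 // => i _.
  by rewrite pair_op_symm ?D_ps; [rewrite subrr mul0r | exact: symm_ps].
by rewrite D_ps mulr1 Dnat mulr0.
Qed.

Lemma top0_ps2 A : top 0 A (ps 2) = 2 * N%:R * (1 + A).
Proof.
rewrite topE (eq_bigr (fun i => 2 * 1)) => [|i _]; last first.
  by rewrite D_ps DM Dnat DX Dz eqxx /=; ring.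
rewrite [X in A * X](eq_bigr (fun i => 2 * 1)) => [|i _]; last first.
  by have xy := zB_nx i; rewrite pair_op_symm ?D_ps; [field | exact: symm_ps].
by rewrite -mulr_sumr sum1; ring.
Qed.

Lemma top0_ps3 A : top 0 A (ps 3) = 6 * (1 + A) * ps 1.
Proof.
rewrite topE (eq_bigr (fun i => 6 * z i ^+ 1)) => [|i _]; last first.
  by rewrite D_ps DM Dnat DX Dz eqxx /=; ring.
rewrite [X in A * X](eq_bigr (fun i => 3 * (z i ^+ 1 + z (nx i) ^+ 1))) => [|i _];
  last first.
  by have xy := zB_nx i; rewrite pair_op_symm ?D_ps; [field | exact: symm_ps].
rewrite -!mulr_sumr big_split /= (sum_nx (fun i => z i ^+ 1)) -/(ps 1); ring.
Qed.

Lemma top1_ps1 A : top 1 A (ps 1) = A * N%:R.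
Proof.
rewrite topE big1 => [|i _]; last by rewrite D_ps DM !Dnat; ring.
rewrite [X in A * X](eq_bigr (fun i => 1)) => [|i _]; last first.
  by have xy := zB_nx i; rewrite pair_op_symm ?D_ps; [field | exact: symm_ps].
by rewrite sum1 add0r.
Qed.

Lemma top1_ps2 A : top 1 A (ps 2) = (2 + 4 * A) * ps 1.
Proof.
rewrite topE (eq_bigr (fun i => 2 * z i ^+ 1)) => [|i _]; last first.
  by rewrite D_ps DM Dnat DX Dz eqxx /=; ring.
rewrite [X in A * X](eq_bigr (fun i => 2 * (z i ^+ 1 + z (nx i) ^+ 1))) => [|i _];
  last first.
  by have xy := zB_nx i; rewrite pair_op_symm ?D_ps; [field | exact: symm_ps].
rewrite -!mulr_sumr big_split /= (sum_nx (fun i => z i ^+ 1)) -/(ps 1); ring.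
Qed.

Lemma top2_ps1 A : top 2 A (ps 1) = 2 * A * ps 1.
Proof.
rewrite topE big1 => [|i _]; last by rewrite D_ps DM !Dnat; ring.
rewrite [X in A * X](eq_bigr (fun i => z i ^+ 1 + z (nx i) ^+ 1)) => [|i _]; last first.
  by have xy := zB_nx i; rewrite pair_op_symm ?D_ps; [field | exact: symm_ps].
rewrite big_split /= (sum_nx (fun i => z i ^+ 1)) -/(ps 1); ring.
Qed.

(** Like tau_(N-1), tau_N is affine in each coordinate: the second derivatives vanish, and each of
    the N neighbour pairs reproduces the function once. *)
Lemma top2_tN A : top 2 A tN = A * N%:R * tN.
Proof.
rewrite topE big1 => [|i _]; last first.
  have i0 := z_neq0 i.
  by rewrite D_tN DM D_tN D_Vz eqxx /=; field.
rewrite [X in A * X](eq_bigr (fun i => 1 * tN)) => [|i _]; last first.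
  have xy := zB_nx i; have i0 := z_neq0 i; have j0 := z_neq0 (nx i).
  rewrite pair_op_symm ?D_tN; last exact: symm_tN.
  by field; rewrite xy i0 j0.
by rewrite -mulr_suml sum1; ring.
Qed.

Lemma top2_tN1 A : top 2 A tN1 = A * N%:R * tN1.
Proof.
rewrite topE big1 => [|i _]; last first.
  have i0 := z_neq0 i.
  rewrite D_tN1 raddfB /= -exprVn (DM i tN1) (DM i tN (_ ^+ 2)) D_tN1
    D_tN DX D_Vz eqxx /=; field.
  by rewrite i0.
rewrite [X in A * X](eq_bigr (fun i => 1 * tN1)) => [|i _]; last first.
  have xy := zB_nx i; have i0 := z_neq0 i; have j0 := z_neq0 (nx i).
  rewrite pair_op_symm ?D_tN1; last exact: symm_tN1.
  by field; rewrite xy i0 j0.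
by rewrite -mulr_suml sum1; ring.
Qed.

(** * Gamma and the first-order operators *)

Lemma Gam0_ps1 y : Gam 0 (ps 1) y = Jm y.
Proof. by apply: eq_bigr => i _; rewrite D_ps; ring. Qed.

Lemma Gam0_ps2 y : Gam 0 (ps 2) y = 2 * J0 y.
Proof. by rewrite /J0 mulr_sumr; apply: eq_bigr => i _; rewrite D_ps /=; ring. Qed.

Lemma Gam0_ps3 y : Gam 0 (ps 3) y = 3 * Jp y.
Proof. by rewrite /Jp mulr_sumr; apply: eq_bigr => i _; rewrite D_ps /=; ring. Qed.

Lemma Gam1_ps1 y : Gam 1 (ps 1) y = J0 y.
Proof. by apply: eq_bigr => i _; rewrite D_ps; ring. Qed.

Lemma Gam2_ps1 y : Gam 2 (ps 1) y = Jp y.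
Proof. by apply: eq_bigr => i _; rewrite D_ps; ring. Qed.

Lemma Gam2_tN y : Gam 2 tN y = tN * J0 y.
Proof.
rewrite /J0 mulr_sumr; apply: eq_bigr => i _; rewrite D_tN.
by have i0 := z_neq0 i; field.
Qed.

Lemma Gam2_tN1_z k : Gam 2 tN1 (z k) = tN1 * z k - tN.
Proof.
rewrite -(sum_delta (fun k => tN1 * z k - tN) k); apply: eq_bigr => i _.
by rewrite D_tN1 Dz; have i0 := z_neq0 i; field.
Qed.

Lemma Jm_1 : Jm 1 = 0.
Proof. by rewrite /Jm big1 // => i _; rewrite D1. Qed.

Lemma Jm_z k : Jm (z k) = 1.
Proof. by rewrite /Jm -[RHS](sum_delta1 k); apply: eq_bigr => i _; rewrite Dz. Qed.

Lemma Jm_ps k : Jm (ps k) = k%:R * ps k.-1.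
Proof. by rewrite /ps mulr_sumr; apply: eq_bigr => i _; rewrite D_ps. Qed.

Lemma Jm_X x n : Jm (x ^+ n) = n%:R * x ^+ n.-1 * Jm x.
Proof. by rewrite /Jm mulr_sumr; apply: eq_bigr => i _; rewrite DX. Qed.

Lemma J0_1 : J0 1 = 0.
Proof. by rewrite /J0 big1 // => i _; rewrite D1 mulr0. Qed.

Lemma J0_z k : J0 (z k) = z k.
Proof. by rewrite /J0 -[RHS](sum_delta z k); apply: eq_bigr => i _; rewrite Dz; case: eqVneq => [->|_] //;
  rewrite !mulr0. Qed.

Lemma J0_Vz k : J0 (z k)^-1 = - (z k)^-1.
Proof.
rewrite -(sum_delta (fun k => - (z k)^-1) k); apply: eq_bigr => i _.
have i0 := z_neq0 i; rewrite D_Vz; case: eqVneq => [<-|_] /=; first by field.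
by rewrite oppr0 mul0r !mulr0.
Qed.

Lemma J0_ps k : J0 (ps k) = k%:R * ps k.
Proof.
rewrite /ps mulr_sumr; apply: eq_bigr => i _; rewrite D_ps.
by case: k => [|k] /=; rewrite ?exprS; ring.
Qed.

Lemma J0_tN : J0 tN = N%:R * tN.
Proof.
rewrite -sum1 mulr_suml; apply: eq_bigr => i _; rewrite D_tN.
by have i0 := z_neq0 i; field.
Qed.

Lemma J0_tN1 : J0 tN1 = (N%:R - 1) * tN1.
Proof.
rewrite mulrBl -sum1 mul1r [X in _ - X]/tN1 mulr_sumr mulr_suml -sumrB.
apply: eq_bigr => i _; rewrite D_tN1; have i0 := z_neq0 i; field.
exact: i0.
Qed.

Lemma J0_X x n : J0 (x ^+ n) = n%:R * x ^+ n.-1 * J0 x.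
Proof. by rewrite /J0 mulr_sumr; apply: eq_bigr => i _; rewrite DX; ring. Qed.

Lemma Jp_z k : Jp (z k) = z k ^+ 2.
Proof. by rewrite -(sum_delta (fun k => z k ^+ 2) k); apply: eq_bigr => i _; rewrite Dz; case: eqVneq => [->|_] //;
  rewrite !mulr0. Qed.

Lemma Jp_Vz k : Jp (z k)^-1 = - 1.
Proof.
rewrite -(sum_delta (fun k => - 1) k); apply: eq_bigr => i _.
have i0 := z_neq0 i; rewrite D_Vz; case: eqVneq => [<-|_] /=; first by field.
by rewrite oppr0 mul0r !mulr0.
Qed.

Lemma Jp_tN1 : Jp tN1 = ps 1 * tN1 - N%:R * tN.
Proof.
rewrite -sum1 /ps !mulr_suml -sumrB; apply: eq_bigr => i _; rewrite D_tN1.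
have i0 := z_neq0 i; field; exact: i0.
Qed.

(** The four terms come from T_0(sigma_2), from 2 Gamma(sigma_2, F) = 4 J^0 F, from Gamma(sigma_2,
    sigma_2) = 4 sigma_2 and from 2 Gamma(sigma_1, sigma_2) = 4 sigma_1; all of them lower the power
    of sigma_2 by one. [top0_k2] comes from Gamma(sigma_1, sigma_1) = N. *)
Definition top0_k1 A e (al be : nat) : K :=
  be%:R * (2 * N%:R * (1 + A) + 4 * e + 4 * be.-1%:R + 4 * al%:R).
Definition top0_k2 (al : nat) : K := al%:R * al.-1%:R * N%:R.

(* The truncated exponents [al.-1], [al.-2], [be.-1] are harmless: where truncation
   occurs the coefficient in front is 0. *)
Lemma top0_step A e al be F : J0 F = e * F ->
  top 0 A (ps 1 ^+ al * ps 2 ^+ be * F) =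
    ps 1 ^+ al * ps 2 ^+ be * top 0 A F
    + 2 * al%:R * (ps 1 ^+ al.-1 * ps 2 ^+ be * Jm F)
    + top0_k1 A e al be * (ps 1 ^+ al * ps 2 ^+ be.-1 * F)
    + top0_k2 al * (ps 1 ^+ al.-2 * ps 2 ^+ be * F).
Proof.
move=> eF; have sa := symmX al (symm_ps 1); have sb := symmX be (symm_ps 2).
rewrite /top0_k1 /top0_k2 topM; last exact: symmM.
rewrite topM // !topX; try exact: symm_ps.
rewrite top0_ps1 top0_ps2 !GamMl !GamXl [Gam 0 (ps 1) (_ ^+ _)]GamC GamXl.
rewrite !Gam0_ps2 !Gam0_ps1 eF J0_ps !Jm_ps J0_ps /= [ps 0]/ps sum1.
by case: al {sa} => [|[|al]]; case: be {sb} => [|[|be]] /=;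
  rewrite -?natr1 ?exprS; ring.
Qed.

Lemma J0_step0 e al be F : J0 F = e * F ->
  J0 (ps 1 ^+ al * ps 2 ^+ be * F) =
    (al%:R + 2 * be%:R + e) * (ps 1 ^+ al * ps 2 ^+ be * F).
Proof.
move=> eF; rewrite !J0M !J0_X !J0_ps eF.
by case: al => [|al]; case: be => [|be] /=;
  rewrite -?natr1 ?exprS; ring.
Qed.

Definition top1_k A e (al : nat) : K := al%:R * (A * N%:R + 2 * e + al.-1%:R).

Lemma top1_step A e al F : J0 F = e * F ->
  top 1 A (ps 1 ^+ al * F) =
    ps 1 ^+ al * top 1 A F + top1_k A e al * (ps 1 ^+ al.-1 * F).
Proof.
move=> eF; have sa := symmX al (symm_ps 1).
rewrite /top1_k topM // topX; last exact: symm_ps.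
rewrite top1_ps1 GamXl !Gam1_ps1 eF J0_ps.
by case: al {sa} => [|[|al]] /=;
  rewrite -?natr1 ?exprS; ring.
Qed.

Lemma J0_step1 e al F : J0 F = e * F ->
  J0 (ps 1 ^+ al * F) = (al%:R + e) * (ps 1 ^+ al * F).
Proof.
by move=> eF; rewrite !J0M !J0_X !J0_ps eF; case: al => [|al] /=;
  rewrite -?natr1 ?exprS; ring.
Qed.

Lemma Jm_step1 al F :
  Jm (ps 1 ^+ al * F) = ps 1 ^+ al * Jm F + al%:R * N%:R * (ps 1 ^+ al.-1 * F).
Proof. by rewrite JmM Jm_X Jm_ps [ps 0]/ps sum1; ring. Qed.

(** Here no power is lost: T_2(tau_N) and Gamma(tau_N, tau_N) are multiples of tau_N and tau_N^2, so
    multiplication by tau_N^al only shifts T_2 by a constant on factors of Euler eigenvalue e. *)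
Definition top2_k A e (al : nat) : K :=
  al%:R * (A * N%:R + 2 * e + al.-1%:R * N%:R).

Lemma top2_step A e al F : J0 F = e * F ->
  top 2 A (tN ^+ al * F) = tN ^+ al * top 2 A F + top2_k A e al * (tN ^+ al * F).
Proof.
move=> eF; have sa := symmX al symm_tN.
rewrite /top2_k topM // topX; last exact: symm_tN.
rewrite top2_tN GamXl !Gam2_tN eF J0_tN.
by case: al {sa} => [|[|al]] /=;
  rewrite -?natr1 ?exprS; ring.
Qed.

Lemma J0_step2 e al F : J0 F = e * F ->
  J0 (tN ^+ al * F) = (N%:R * al%:R + e) * (tN ^+ al * F).
Proof.
by move=> eF; rewrite !J0M !J0_X !J0_tN eF; case: al => [|al] /=;
  rewrite -?natr1 ?exprS; ring.
Qed.

(** * Values on the mixed factors Phi *)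

Lemma top0_ps3z A k :
  top 0 A (ps 3 * z k) = 6 * (1 + A) * (ps 1 * z k) + 6 * z k ^+ 2.
Proof.
rewrite topM; last exact: symm_ps.
by rewrite top0_z top0_ps3 Gam0_ps3 Jp_z; ring.
Qed.

Lemma Jm_ps3z k : Jm (ps 3 * z k) = 3 * (ps 2 * z k) + ps 3.
Proof. by rewrite JmM Jm_ps Jm_z /=; ring. Qed.

Lemma J0_ps3z k : J0 (ps 3 * z k) = 4%:R * (ps 3 * z k).
Proof. by rewrite J0M J0_ps J0_z; ring. Qed.

Lemma Jm_z2 k : Jm (z k ^+ 2) = 2 * z k.
Proof. by rewrite Jm_X Jm_z /=; ring. Qed.

Lemma J0_z2 k : J0 (z k ^+ 2) = 2%:R * z k ^+ 2.
Proof. by rewrite J0_X J0_z /=; ring. Qed.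

Lemma Jm_zz j k : Jm (z j * z k) = z j + z k.
Proof. by rewrite JmM !Jm_z; ring. Qed.

Lemma J0_zz j k : J0 (z j * z k) = 2%:R * (z j * z k).
Proof. by rewrite J0M !J0_z; ring. Qed.

Lemma Jm_w j k : Jm (z j * z k * (z j - z k)) = z j ^+ 2 + -1 * z k ^+ 2.
Proof. by rewrite mulrBr -!mulrA /Jm; under eq_bigr do rewrite raddfB;
  rewrite sumrB -!/(Jm _) !JmM !Jm_z; ring. Qed.

Lemma J0_w j k :
  J0 (z j * z k * (z j - z k)) = 3%:R * (z j * z k * (z j - z k)).
Proof. by rewrite J0M J0M /J0; under [X in _ + _ * X = _]eq_bigr do rewrite raddfB mulrBr;
  rewrite sumrB -!/(J0 _) !J0_z; ring. Qed.

Lemma top2_ps1tN1 A : top 2 A (ps 1 * tN1) =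
  (2 * A + A * N%:R + 2) * (ps 1 * tN1) - 2 * N%:R * tN.
Proof.
rewrite topM; last exact: symm_ps.
by rewrite top2_tN1 top2_ps1 Gam2_ps1 Jp_tN1; ring.
Qed.

Lemma J0_ps1tN1 : J0 (ps 1 * tN1) = N%:R * (ps 1 * tN1).
Proof. by rewrite J0M J0_ps J0_tN1; ring. Qed.

Lemma top2_tN1z A k : top 2 A (tN1 * z k) =
  (2 * A + A * N%:R + 2) * (tN1 * z k) - 2 * tN.
Proof.
rewrite topM; last exact: symm_tN1.
by rewrite top2_tN1 top2_z Gam2_tN1_z; ring.
Qed.

Lemma J0_tN1z k : J0 (tN1 * z k) = N%:R * (tN1 * z k).
Proof. by rewrite J0M J0_z J0_tN1; ring. Qed.

Lemma top2_tNVz A k : top 2 A (tN * (z k)^-1) = A * N%:R * (tN * (z k)^-1).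
Proof.
rewrite topM; last exact: symm_tN.
by rewrite top2_tN top2_Vz Gam2_tN J0_Vz; ring.
Qed.

Lemma J0_tNVz k : J0 (tN * (z k)^-1) = (N%:R - 1) * (tN * (z k)^-1).
Proof. by rewrite J0M J0_Vz J0_tN; ring. Qed.

Lemma top2_tNps1Vz A k : top 2 A (tN * (ps 1 * (z k)^-1)) =
  (2 + 2 * A + A * N%:R) * (tN * (ps 1 * (z k)^-1)) - 2 * tN.
Proof.
rewrite topM; last exact: symm_tN.
rewrite topM; last exact: symm_ps.
by rewrite Gam2_tN J0M top2_tN top2_Vz top2_ps1 Gam2_ps1 Jp_Vz J0_Vz J0_ps; ring.
Qed.

Lemma J0_tNps1Vz k : J0 (tN * (ps 1 * (z k)^-1)) = N%:R * (tN * (ps 1 * (z k)^-1)).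
Proof. by rewrite !J0M J0_Vz J0_tN J0_ps; ring. Qed.

(** Common shape of the three gauge Hamiltonians; c2 is set to 0 for eps = 0 and 2, where J^- does
    not occur. *)
Definition ham eps (A c1 c2 c3 c4 x : K) : K :=
  c1 * top eps A x + c2 * Jm x + c3 * J0 x + c4 * x.

Lemma hamD eps A c1 c2 c3 c4 x y :
  ham eps A c1 c2 c3 c4 (x + y) = ham eps A c1 c2 c3 c4 x + ham eps A c1 c2 c3 c4 y.
Proof. by rewrite /ham topD JmD J0D; ring. Qed.

Lemma hamMc eps A c1 c2 c3 c4 k x : isconst k ->
  ham eps A c1 c2 c3 c4 (k * x) = k * ham eps A c1 c2 c3 c4 x.
Proof. by move=> kc; rewrite /ham topMc // JmMc // J0Mc //; ring. Qed.

End DifferenceDifferential.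

(** * Rational functions of the coordinates *)

Section QuotientRules.
Variables (A : comNzRingType) (K : fieldType) (f : {rmorphism A -> K}).
Variables (p q r s p' q' r' s' : A).
Hypotheses (q0 : f q != 0) (s0 : f s != 0).

Lemma quotB : f p / f q - f r / f s = f (p * s - r * q) / f (q * s).
Proof. by rewrite rmorphB !rmorphM /=; field; rewrite q0 s0. Qed.

Lemma quotM : f p / f q * (f r / f s) = f (p * r) / f (q * s).
Proof. by rewrite !rmorphM /=; field; rewrite q0 s0. Qed.

(** The primed elements stand for derivatives but may be arbitrary: additivity and the Leibniz rule
    of the quotient formula are identities in p, q, r, s and their primed counterparts. *)
Lemma quot_ruleB :
  f ((p' * s + p * s' - (r' * q + r * q')) * (q * s)
     - (p * s - r * q) * (q' * s + q * s')) / f (q * s) ^+ 2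
  = f (p' * q - p * q') / f q ^+ 2 - f (r' * s - r * s') / f s ^+ 2.
Proof. by rewrite !(rmorphB, rmorphD, rmorphM) /=; field; rewrite q0 s0. Qed.

Lemma quot_ruleM :
  f ((p' * r + p * r') * (q * s) - (p * r) * (q' * s + q * s')) / f (q * s) ^+ 2
  = f (p' * q - p * q') / f q ^+ 2 * (f r / f s)
    + f p / f q * (f (r' * s - r * s') / f s ^+ 2).
Proof. by rewrite !(rmorphB, rmorphD, rmorphM) /=; field; rewrite q0 s0. Qed.

End QuotientRules.

Section RationalCalculus.
Variables (R : realType) (N : nat).
Local Notation C := R[i].
Local Notation P := (polyz R N).
Local Notation F := {fraction {mpoly C[N]}}.

Let tofrac_rmorph : {rmorphism P -> F} := FracField.tofrac (R := P).

Lemma pol_eq0 (p : P) : (pol p == 0) = (p == 0).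
Proof. exact: tofrac_eq0. Qed.

Lemma polD (p q : P) : pol (p + q) = pol p + pol q.
Proof. exact: tofracD. Qed.

Lemma polM (p q : P) : pol (p * q) = pol p * pol q.
Proof. exact: tofracM. Qed.

Lemma pol1 : pol 1 = 1 :> F.
Proof. exact: tofrac1. Qed.

Lemma polX (p : P) n : pol (p ^+ n) = pol p ^+ n.
Proof. exact: tofracXn. Qed.

Lemma pol_sum I (r : seq I) (Q : pred I) (f : I -> P) :
  pol (\sum_(i <- r | Q i) f i) = \sum_(i <- r | Q i) pol (f i).
Proof. exact: (rmorph_sum (FracField.tofrac (R := P))). Qed.

Lemma pol_prod I (r : seq I) (Q : pred I) (f : I -> P) :
  pol (\prod_(i <- r | Q i) f i) = \prod_(i <- r | Q i) pol (f i).
Proof. exact: (rmorph_prod (FracField.tofrac (R := P))). Qed.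

Lemma frac_ex (x : F) : exists p q : P, q != 0 /\ x = pol p / pol q.
Proof.
exists (\n_(repr x)), (\d_(repr x)); split; first exact: denom_ratioP.
have d0 : \d_(repr x) != 0 by exact: denom_ratioP.
rewrite -[LHS]reprK; apply: (canRL (mulfK _)); first by rewrite tofrac_eq0.
rewrite /pol !piE; apply/eqmodP; rewrite /= FracField.equivfE /FracField.mulf.
by rewrite !numden_Ratio ?mulr1 ?oner_neq0 // mulrC.
Qed.

Lemma fderiv_pol i (p : P) : fderiv i (pol p) = pol p^`M(i).
Proof.
have := fderivE i p (oner_neq0 P).
by rewrite pol1 divr1 -mpolyC1 mderivC mulr0 subr0 mpolyC1 mulr1 expr1n divr1.
Qed.

Lemma fperm_pol s (p : P) : fperm s (pol p) = pol (msym s p).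
Proof. by have := fpermE s p (oner_neq0 P); rewrite msym1 pol1 !divr1. Qed.

Lemma msym_neq0 s (q : P) : q != 0 -> msym s q != 0.
Proof.
apply: contraNneq => e; have /eqP := congr1 (msym s^-1%g) e.
by rewrite -msymMm mulgV msym1m msym0.
Qed.

Lemma fderiv_zmod i : zmod_morphism (@fderiv R N i).
Proof.
move=> x y; have [p [q [q0 ->]]] := frac_ex x; have [r [s [s0 ->]]] := frac_ex y.
have pq : pol q != 0 by rewrite pol_eq0.
have ps : pol s != 0 by rewrite pol_eq0.
rewrite [X in fderiv i X](quotB (f := tofrac_rmorph) p r pq ps) !fderivE ?mulf_neq0 //.
rewrite mderivB !mderivM;
  exact: (quot_ruleB (f := tofrac_rmorph) p r p^`M(i) q^`M(i) r^`M(i) s^`M(i) pq ps).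
Qed.

HB.instance Definition _ i :=
  GRing.isZmodMorphism.Build F F (@fderiv R N i) (fderiv_zmod i).

Lemma fderivM i (x y : F) : fderiv i (x * y) = fderiv i x * y + x * fderiv i y.
Proof.
have [p [q [q0 ->]]] := frac_ex x; have [r [s [s0 ->]]] := frac_ex y.
have pq : pol q != 0 by rewrite pol_eq0.
have ps : pol s != 0 by rewrite pol_eq0.
rewrite [X in fderiv i X](quotM (f := tofrac_rmorph) p r pq ps) !fderivE ?mulf_neq0
  // !mderivM.
exact: (quot_ruleM (f := tofrac_rmorph) p r p^`M(i) q^`M(i) r^`M(i) s^`M(i) pq ps).
Qed.

Lemma fperm_zmod s : zmod_morphism (@fperm R N s).
Proof.
move=> x y; have [p [q [q0 ->]]] := frac_ex x; have [r [t [t0 ->]]] := frac_ex y.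
have pq : pol q != 0 by rewrite pol_eq0.
have pt : pol t != 0 by rewrite pol_eq0.
rewrite [X in fperm s X](quotB (f := tofrac_rmorph) p r pq pt) !fpermE ?mulf_neq0 //.
rewrite msymB !msymM; symmetry;
  apply: (quotB (f := tofrac_rmorph)); rewrite tofrac_eq0; exact: msym_neq0.
Qed.

Lemma fperm_monoid s : monoid_morphism (@fperm R N s).
Proof.
split=> [|x y]; first by rewrite -pol1 fperm_pol msym1.
have [p [q [q0 ->]]] := frac_ex x; have [r [t [t0 ->]]] := frac_ex y.
have pq : pol q != 0 by rewrite pol_eq0.
have pt : pol t != 0 by rewrite pol_eq0.
rewrite [X in fperm s X](quotM (f := tofrac_rmorph) p r pq pt) !fpermE ?mulf_neq0 //.
rewrite !msymM; symmetry;
  apply: (quotM (f := tofrac_rmorph)); rewrite tofrac_eq0; exact: msym_neq0.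
Qed.

HB.instance Definition _ s :=
  GRing.isZmodMorphism.Build F F (@fperm R N s) (fperm_zmod s).
HB.instance Definition _ s :=
  GRing.isMonoidMorphism.Build F F (@fperm R N s) (fperm_monoid s).

Lemma fderiv_z (i j : 'I_N) : fderiv i (zcoord R j) = (i == j)%:R.
Proof.
rewrite /zcoord fderiv_pol mderivX mnm1E eq_sym.
case: eqVneq => [->|_]; last by rewrite scale0r /pol tofrac0.
by rewrite -[X in (X - _)%MM]add0m addmK scale1r mpolyX0 pol1.
Qed.

Lemma fperm_z (s : 'S_N) j : fperm s (zcoord R j) = zcoord R (s j).
Proof. by rewrite /zcoord fperm_pol /msym mmapX mmap1U. Qed.

Lemma zcoord_inj : injective (@zcoord R N).
Proof.
move=> i j /eqP; rewrite /zcoord tofrac_eq => /eqP /(congr1 (mcoeff U_(i))).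
rewrite !mcoeffX eqxx eq_mnm1 eq_sym; case: eqVneq => // _ /eqP.
by rewrite oner_eq0.
Qed.

Lemma zcoord_neq0 (i : 'I_N) : zcoord R i != 0.
Proof.
rewrite pol_eq0; apply/eqP => /(congr1 (mcoeff U_(i))) /eqP.
by rewrite mcoeffX eqxx mcoeff0 oner_eq0.
Qed.

Lemma cstD c d : cst N (c + d) = cst N c + cst N d :> F.
Proof. by rewrite /cst mpolyCD polD. Qed.

Lemma cstM c d : cst N (c * d) = cst N c * cst N d :> F.
Proof. by rewrite /cst mpolyCM polM. Qed.

Lemma cst1 : cst N 1 = 1 :> F.
Proof. by rewrite /cst mpolyC1 pol1. Qed.

Lemma cst0 : cst N 0 = 0 :> F.
Proof. by rewrite /cst mpolyC0 /pol tofrac0. Qed.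

Lemma cstN c : cst N (- c) = - cst N c :> F.
Proof. by rewrite /cst mpolyCN /pol tofracN. Qed.

Lemma cst_sum I (r : seq I) (Q : pred I) (f : I -> C) :
  cst N (\sum_(i <- r | Q i) f i) = \sum_(i <- r | Q i) cst N (f i) :> F.
Proof. by rewrite (big_morph (@cst R N) cstD cst0). Qed.

Lemma cst_nat k : cst N k%:R = k%:R :> F.
Proof. by elim: k => [|k IH]; rewrite ?cst0 // -!natr1 cstD IH cst1. Qed.

Lemma natF_neq0 k : k.+1%:R != 0 :> F.
Proof. by rewrite -cst_nat pol_eq0 mpolyC_eq0 pnatr_eq0. Qed.

Lemma cst_natV k : cst N k.+1%:R^-1 = k.+1%:R^-1 :> F.
Proof.
apply: (mulfI (natF_neq0 k)); rewrite mulfV ?natF_neq0 //.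
by rewrite -cst_nat -cstM mulfV ?cst1 // pnatr_eq0.
Qed.

Definition is_cst (x : F) : Prop := exists c, x = cst N c.

Lemma is_cst_rcst x : is_cst (rcst N x).
Proof. by exists x%:C. Qed.

Lemma is_cst_nat k : is_cst k%:R.
Proof. by exists k%:R; rewrite cst_nat. Qed.

Lemma is_cst1 : is_cst 1.
Proof. by exists 1; rewrite cst1. Qed.

Lemma is_cstD x y : is_cst x -> is_cst y -> is_cst (x + y).
Proof. by move=> [c ->] [d ->]; exists (c + d); rewrite cstD. Qed.

Lemma is_cstM x y : is_cst x -> is_cst y -> is_cst (x * y).
Proof. by move=> [c ->] [d ->]; exists (c * d); rewrite cstM. Qed.

Lemma is_cstN x : is_cst x -> is_cst (- x).
Proof. by move=> [c ->]; exists (- c); rewrite cstN. Qed.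

Variable hN : (2 < N)%N.

Definition frac_calculus : calculus F N :=
  @Calculus F N (fun i => @fderiv R N i : {additive F -> F})
    (fun s => @fperm R N s : {rmorphism F -> F}) (@zcoord R N)
    fderivM fderiv_z fperm_z zcoord_inj zcoord_neq0 (natF_neq0 1) hN.
Local Notation X := frac_calculus.

Lemma isconst_cst c : isconst X (cst N c).
Proof.
split=> [i|s] /=; rewrite /cst; first by rewrite fderiv_pol mderivC /pol tofrac0.
by rewrite fperm_pol /msym mmapC.
Qed.

Lemma TopE eps a x : Top eps a x = top X eps (rcst N (2 * a)) x.
Proof. by []. Qed.

Lemma JzeroE x : Jzero x = J0 X x.
Proof. by []. Qed.

Lemma JminusE x : Jminus x = Jm X x.
Proof. by []. Qed.

Lemma pol_sigma k : pol (sigma R N k) = ps X k.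
Proof. by rewrite pol_sum; apply: eq_bigr => i _; rewrite polX. Qed.

Lemma pol_tauN : pol (tau R N N) = tN X.
Proof. by rewrite /tau mesymnnE pol_prod. Qed.

(** A set of N - 1 positions is the complement of a single position i, and its product is tau_N /
    z_i. *)
Lemma pol_tauN1 : pol (tau R N N.-1) = tN1 X.
Proof.
have N0 : (0 < N)%N by case: N hN.
rewrite /tau /mesym pol_sum /tN1 mulr_sumr.
(* The inverse map picks an element outside h. For h of size N - 1 there is exactly one, so the
   default of [odflt] is never reached. *)
rewrite (reindex_onto (fun i : 'I_N => [set~ i]) (fun h => odflt (Ordinal N0)
  [pick x in ~: h])) /=.
  apply: eq_big => [i|i _].
    rewrite cardsC1 card_ord eqxx setCK; case: pickP => [x|/(_ i)];
      last by rewrite !inE eqxx.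
    by rewrite inE => /eqP -> /=; rewrite eqxx.
  rewrite pol_prod /tN [\prod_i zvar X i](bigD1 i) //= mulrC mulKf ?(zvar_neq0 X) //.
  by apply: eq_bigl => j; rewrite !inE.
move=> h /eqP hh; have /eqP/cards1P[x hx] : #|~: h| = 1%N.
  by have := cardsC h; rewrite card_ord hh; lia.
rewrite -[RHS]setCK hx; congr (~: _); congr [set _].
by case: pickP => [y|/(_ x)]; rewrite !inE ?eqxx // => /eqP.
Qed.

End RationalCalculus.

(** * Composition with homogeneous polynomials *)

Section WeightedComposition.
Variables (C : numFieldType) (n : nat).

Lemma dhomog_msize_le (p : {mpoly C[n]}) d : p \is d.-homog -> (msize p <= d.+1)%N.
Proof.
move=> /dhomogP hp; rewrite msizeE; apply/bigmax_leqP_seq => m mp _.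
by rewrite ltnS; have /= -> := hp m mp.
Qed.

(** In characteristic 0 the coefficient of m reappears, multiplied by m_i, at m - U_i in the
    derivative. This and the next lemma turn the conditions on f, g, q into bounds on exponents. *)
Lemma mderiv_eq0 (p : {mpoly C[n]}) i m : p^`M(i) = 0 -> m \in msupp p -> m i = 0%N.
Proof.
move=> p0 mp; apply/eqP; apply: contraLR mp; rewrite -lt0n => mi.
have le1 : (U_(i) <= m)%MM by rewrite lep1mP -lt0n.
have := congr1 (mcoeff (m - U_(i))%MM) p0.
rewrite mcoeff_deriv submK // mcoeff0 => /eqP.
by rewrite mulrn_eq0 /= mcoeff_eq0.
Qed.

Lemma mderiv2_eq0 (p : {mpoly C[n]}) i m :
  p^`M(i)^`M(i) = 0 -> m \in msupp p -> (m i <= 1)%N.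
Proof.
move=> p0 mp; rewrite leqNgt; apply/negP => mi.
have le1 : (U_(i) <= m)%MM by rewrite lep1mP -lt0n; apply: ltnW.
suff /(mderiv_eq0 p0) : (m - U_(i))%MM \in msupp p^`M(i).
  by rewrite mnmBE mnm1E eqxx => h; move: mi; rewrite -subn_gt0 subn1 -subn1 h.
by rewrite mcoeff_msupp mcoeff_deriv submK // mulrn_eq0 /= -mcoeff_msupp.
Qed.

Lemma mderivX_eq0 i (m : 'X_{1..n}) : m i = 0%N -> ('X_[m] : {mpoly C[n]})^`M(i) = 0.
Proof. by move=> mi; rewrite mderivX mi scale0r. Qed.

Lemma mderiv2X_eq0 i (m : 'X_{1..n}) :
  (m i <= 1)%N -> ('X_[m] : {mpoly C[n]})^`M(i)^`M(i) = 0.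
Proof.
move=> mi; rewrite mderivX mderivZ mderivX mnmBE mnm1E eqxx.
have -> : (m i - 1 = 0)%N by apply/eqP.
by rewrite scale0r scaler0.
Qed.

End WeightedComposition.

Section Composition.
Variables (C : numFieldType) (n k : nat) (t : k.-tuple {mpoly C[n]}) (w : 'I_k -> nat).
Hypothesis t_homog : forall i, tnth t i \is (w i).-homog.

Definition wdeg (m : 'X_{1..k}) : nat := \sum_i w i * m i.

Lemma comp_mono_homog m : 'X_[m] \mPo t \is (wdeg m).-homog.
Proof.
rewrite comp_mpolyX /wdeg.
elim/big_rec2: _ => [|i d p _ hp]; first exact: dhomog1.
by apply: dhomogM hp; apply: dhomogMn.
Qed.

(* Cancellation between monomials of different weighted degree is impossible,
   so those exceeding the degree of f(t) contribute nothing in total. *)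
Lemma comp_mpoly_trunc (f : {mpoly C[k]}) (d : int) : (msize (f \mPo t))%:Z <= d + 1 ->
  f \mPo t = \sum_(m <- msupp f | (wdeg m)%:Z <= d) f@_m *: ('X_[m] \mPo t).
Proof.
move=> fd; apply/mpolyP => e; rewrite [RHS](raddf_sum (mcoeff e)).
have coef0 m : wdeg m != mdeg e -> (f@_m *: ('X_[m] \mPo t))@_e = 0.
  by move=> we; rewrite mcoeffZ (dhomog_nemf_coeff (comp_mono_homog m)) ?mulr0 // eq_sym.
(* At a degree within the bound the dropped monomials have no coefficient, being homogeneous of
   larger degree; at a degree beyond it the kept ones have none, and neither has f(t) by
   hypothesis. *)
case: (lerP (mdeg e)%:Z d) => ed.
  rewrite comp_mpolyEX (raddf_sum (mcoeff e)) (bigID (fun m => (wdeg m)%:Z <= d)) /=.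
  rewrite [X in _ + X]big1 ?addr0 // => m md; apply: coef0.
  by apply: contraNneq md => ->.
rewrite big1 => [|m md]; last by apply: coef0; apply: contraTneq ed => <-; rewrite -leNgt.
apply/eqP; rewrite mcoeff_eq0; apply: msize_mdeg_ge; lia.
Qed.

End Composition.

(** * Spin states *)

Section States.
Variables (R : realType) (N : nat) (twoM : nat).
Local Notation C := R[i].
Local Notation F := {fraction {mpoly C[N]}}.
Local Notation spins := (spinspace R N twoM).
Local Notation state := (states R N twoM).

(* [Lambda] applied to a spin vector v with coordinate part m has components
   sum_s m^s v(c o s) / N!; [avg] allows any family M in place of s |-> m^s. *)
Definition avg (M : 'S_N -> F) (v : spins) : state :=
  [ffun c : config N twoM =>
     \sum_(s : 'S_N) cst N ((N`!%:R)^-1 * (v [ffun k => c (s k)] : C)) * M s].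

Lemma factE : (N`!%:R)^-1 = cst N (N`!%:R)^-1 :> F.
Proof. by case: N`! (fact_gt0 N) => // k _; rewrite cst_natV. Qed.

Lemma avg_ext M M' v : M =1 M' -> avg M v = avg M' v.
Proof. by move=> e; apply/ffunP => c; rewrite !ffunE; apply: eq_bigr => s _; rewrite e. Qed.

Lemma avgZ (k : F) M v : k *: avg M v = avg (fun s => k * M s) v.
Proof.
apply/ffunP => c; rewrite !ffunE -[_ *: _]/(k * _) mulr_sumr.
by apply: eq_bigr => s _; rewrite mulrCA.
Qed.

Lemma avgD M M' v : avg M v + avg M' v = avg (fun s => M s + M' s) v.
Proof.
apply/ffunP => c; rewrite !ffunE -big_split /=.
by apply: eq_bigr => s _; rewrite mulrDr.
Qed.

Lemma fperm_cst s c : fperm s (cst N c) = cst N c :> F.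
Proof. by rewrite /cst fperm_pol /msym mmapC. Qed.

Lemma Lambda_avg (m : F) (v : spins) :
  Lambda (m *: ket v) = avg (fun s => fperm s m) v.
Proof.
apply/ffunP => c; rewrite !ffunE sum_ffunE -[_ *: _]/(_ * _) mulr_sumr.
apply: eq_bigr => s _; rewrite !ffunE -[_ *: _]/(_ * _) rmorphM /= fperm_cst factE.
by rewrite cstM -mulrA; congr (_ * _); rewrite mulrC.
Qed.

Lemma Lambda_ket (v : spins) : Lambda (ket v) = avg (fun=> 1) v.
Proof.
by rewrite -[ket v]scale1r Lambda_avg; apply: avg_ext => s; rewrite rmorph1.
Qed.

(** Translating the summation over the group trades a permutation of the spin vector for one of the
    coordinate family. *)
Lemma avg_spin_act (t : 'S_N) M v :
  avg M (spin_act t v) = avg (fun s => M (t^-1 * s)%g) v.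
Proof.
apply/ffunP => c; rewrite !ffunE [RHS](reindex_inj (mulgI t)) /=.
apply: eq_bigr => s _; rewrite ffunE mulKg; congr (cst N (_ * v _) * _).
by apply/ffunP => k; rewrite !ffunE permM.
Qed.

(** For N > 3 the neighbour sums are not invariant under all of S_N, so the Hamiltonian cannot be
    moved past [Lambda]. It is applied to every permuted coordinate part instead; this suffices
    because the resulting formulas are uniform in s. *)
Lemma on_states_avg (O : F -> F) M v :
  (forall x y, O (x + y) = O x + O y) ->
  (forall c x, O (cst N c * x) = cst N c * O x) ->
  on_states O (avg M v) = avg (fun s => O (M s)) v.
Proof.
move=> OD OZ; apply/ffunP => c; rewrite !ffunE.
have O0 : O 0 = 0 by have := OZ 0 0; rewrite cst0 !mul0r.
by rewrite (big_morph O OD O0); apply: eq_bigr => s _; rewrite OZ.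
Qed.

Definition lin_closed (S : state -> Prop) : Prop :=
  [/\ S 0, forall x y, S x -> S y -> S (x + y)
    & forall c x, S x -> S (cst N c *: x)].

Lemma cspan_closed (G : state -> Prop) : lin_closed (cspan G).
Proof.
split=> [|x y [k [c [phi [Gp ->]]]] [l [d [psi [Gq ->]]]]|d x [k [c [phi [Gp ->]]]]].
- by exists 0%N, (fun=> 0), (fun=> 0); split; [case | rewrite big_ord0].
- exists (k + l)%N,
    (fun i => match split i with inl j => c j | inr j => d j end),
    (fun i => match split i with inl j => phi j | inr j => psi j end).
  split=> [i|]; first by case: split.
  rewrite big_split_ord /=; congr (_ + _); apply: eq_bigr => i _.
    by rewrite (unsplitK (inl _ i)).
  by rewrite (unsplitK (inr _ i)).
- exists k, (fun i => d * c i), phi; split=> //.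
  by rewrite scaler_sumr; apply: eq_bigr => i _; rewrite scalerA cstM.
Qed.

Lemma cspan_gen (G : state -> Prop) x : G x -> cspan G x.
Proof.
move=> Gx; exists 1%N, (fun=> 1), (fun=> x); split=> //.
by rewrite big_ord1 cst1 scale1r.
Qed.

Lemma lin_closed_sum (S : state -> Prop) I (r : seq I) (Q : pred I) (f : I -> state) :
  lin_closed S -> (forall i, Q i -> S (f i)) -> S (\sum_(i <- r | Q i) f i).
Proof. by case=> S0 SD _ h; elim/big_ind: _. Qed.

Lemma cspan_min (G S : state -> Prop) x :
  lin_closed S -> (forall y, G y -> S y) -> cspan G x -> S x.
Proof.
move=> Sl h [k [c [phi [Gp ->]]]]; apply: lin_closed_sum => // i _.
by case: Sl => _ _; apply; apply: h.
Qed.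

(** The preimage of a subspace is a subspace: together with [cspan_min] and [comp_mpoly_ind] it
    reduces invariance to generators, and then to monomials. *)
Lemma lin_closed_on_states (O : F -> F) (S : state -> Prop) :
  (forall x y, O (x + y) = O x + O y) ->
  (forall c x, O (cst N c * x) = cst N c * O x) ->
  lin_closed S -> lin_closed (fun x => S (on_states O x)).
Proof.
move=> OD OZ [S0 SD SZ]; split.
- suff -> : on_states O (0 : state) = 0 by [].
  by apply/ffunP => c; rewrite !ffunE; have := OZ 0 0; rewrite cst0 !mul0r.
- move=> x y Sx Sy; suff -> : on_states O (x + y) = on_states O x + on_states O y by apply: SD.
  by apply/ffunP => c; rewrite !ffunE OD.
- move=> d x Sx; suff -> : on_states O (cst N d *: x) = cst N d *: on_states O x by apply: SZ.
  by apply/ffunP => c; rewrite !ffunE -![_ *: _]/(_ * _) OZ.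
Qed.

(** Membership in [msupp f] is handed on with each monomial so that the derivative conditions on f
    still bound its exponents. *)
Lemma comp_mpoly_ind (S : state -> Prop) k (f : {mpoly C[k]})
    (t : k.-tuple {mpoly C[N]}) (w : 'I_k -> nat) (d : int) (x : state) :
  lin_closed S -> (forall i, tnth t i \is (w i).-homog) -> deg_le (f \mPo t) d ->
  (forall m, m \in msupp f -> (wdeg w m)%:Z <= d -> S (pol ('X_[m] \mPo t) *: x)) ->
  S (pol (f \mPo t) *: x).
Proof.
move=> Sl th fd h; rewrite (comp_mpoly_trunc th fd) pol_sum scaler_suml big_seq_cond.
apply: lin_closed_sum => // m /andP[mf md].
rewrite -mul_mpolyC polM -scalerA -/(cst N _); case: Sl => _ _; apply.
exact: h.
Qed.

End States.

Ltac prove_cst := repeat first [ assumption | lazymatch goal with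
  | |- is_cst (rcst _ _) => exact: is_cst_rcst
  | |- is_cst (@Algebra.natmul _ _ _) => exact: is_cst_nat
  | |- is_cst (@GRing.one _) => exact: is_cst1
  | |- is_cst (@Algebra.opp _ _) => apply: is_cstN
  | |- is_cst (@GRing.mul _ _ _) => apply: is_cstM
  | |- is_cst (@Algebra.add _ _ _) => apply: is_cstD
  end ].

(** * Families of coordinate parts whose averages lie in a given subspace *)

Section Families.
Variables (R : realType) (N : nat) (hN : (2 < N)%N) (twoM n : nat).
Local Notation C := R[i].
Local Notation F := {fraction {mpoly C[N]}}.
Local Notation spins := (spinspace R N twoM).
Local Notation state := (states R N twoM).
Local Notation X := (frac_calculus R hN).
Variables (S : state -> Prop) (S_lin : lin_closed S) (v : spins).

Definition avg_in (M : 'S_N -> F) : Prop := S (avg M v).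

Lemma avg_in_ext M M' : M =1 M' -> avg_in M -> avg_in M'.
Proof. by move=> e; rewrite /avg_in (avg_ext v e). Qed.

Lemma avg_inD M M' : avg_in M -> avg_in M' -> avg_in (fun s => M s + M' s).
Proof. by rewrite /avg_in -avgD; case: S_lin => _ SD _; apply: SD. Qed.

Lemma avg_inZ k M : is_cst k -> avg_in M -> avg_in (fun s => k * M s).
Proof. by case=> c ->; rewrite /avg_in -avgZ; case: S_lin => _ _; apply. Qed.

Lemma avg_in0 : avg_in (fun=> 0).
Proof.
apply: (@avg_in_ext (fun s => 0 * 1)) => [s|]; first by rewrite mul0r.
rewrite /avg_in -avgZ scale0r; by case: S_lin.
Qed.

(** The J^- term enters with its coefficient, so that for c2 = 0 nothing has to be known about J^-
    of the family. This matters for eps = 2, where J^- tau_N = tau_(N-1) would break the pattern. *)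
Lemma avg_in_ham eps A c1 c2 c3 c4 M :
  is_cst c1 -> is_cst c3 -> is_cst c4 ->
  avg_in (fun s => top X eps A (M s)) -> avg_in (fun s => c2 * Jm X (M s)) ->
  avg_in (fun s => J0 X (M s)) -> avg_in M -> avg_in (fun s => ham X eps A c1 c2 c3 c4 (M s)).
Proof.
move=> k1 k3 k4 mT mm m0 mM; rewrite /ham.
apply: avg_inD; last exact: avg_inZ.
apply: avg_inD; last exact: avg_inZ.
by apply: avg_inD => //; apply: avg_inZ.
Qed.

(* The weight families for eps = 0, 1, 2: all products of Phi with monomials
   in the symmetric functions of unrestricted exponent, up to degree n, when
   Phi has degree e. *)
Definition fam0 (Phi : 'S_N -> F) (e : nat) : Prop := forall al be,
  (al + 2 * be + e <= n)%N -> avg_in (fun s => ps X 1 ^+ al * ps X 2 ^+ be * Phi s).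
Definition fam1 (Phi : 'S_N -> F) (e : nat) : Prop := forall al,
  (al + e <= n)%N -> avg_in (fun s => ps X 1 ^+ al * Phi s).
Definition fam2 (Phi : 'S_N -> F) (e : nat) : Prop := forall al,
  (N * al + e <= n)%N -> avg_in (fun s => tN X ^+ al * Phi s).

Lemma fam0_ext Phi Phi' e : Phi =1 Phi' -> fam0 Phi e -> fam0 Phi' e.
Proof. by move=> h f al be /f; apply: avg_in_ext => s; rewrite h. Qed.

Lemma fam0D Phi Psi e : fam0 Phi e -> fam0 Psi e -> fam0 (fun s => Phi s + Psi s) e.
Proof.
move=> f g al be le; apply: avg_in_ext (avg_inD (f _ _ le) (g _ _ le)) => s.
by rewrite mulrDr.
Qed.

Lemma fam0Z k Phi e : is_cst k -> fam0 Phi e -> fam0 (fun s => k * Phi s) e.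
Proof.
move=> kc f al be le; apply: avg_in_ext (avg_inZ kc (f _ _ le)) => s.
by rewrite mulrCA.
Qed.

Lemma fam00 e : fam0 (fun=> 0) e.
Proof. by move=> al be _; apply: avg_in_ext avg_in0 => s; rewrite mulr0. Qed.

Lemma fam0W Phi e e' : (e <= e')%N -> fam0 Phi e -> fam0 Phi e'.
Proof. by move=> ee f al be le; apply: f; lia. Qed.

Lemma fam0_ps1 Phi e e' : (e < e')%N -> fam0 Phi e -> fam0 (fun s => ps X 1 * Phi s) e'.
Proof.
move=> ee f al be le; have h : (al.+1 + 2 * be + e <= n)%N by lia.
apply: avg_in_ext (f _ _ h) => s; rewrite exprSr mulrA; congr (_ * _).
by rewrite mulrAC.
Qed.

Lemma fam0_ps2 Phi e e' : (e.+1 < e')%N -> fam0 Phi e -> fam0 (fun s => ps X 2 * Phi s) e'.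
Proof.
move=> ee f al be le; have h : (al + 2 * be.+1 + e <= n)%N by lia.
by apply: avg_in_ext (f _ _ h) => s; rewrite exprSr !mulrA.
Qed.

Lemma fam1Z k Phi e : is_cst k -> fam1 Phi e -> fam1 (fun s => k * Phi s) e.
Proof.
move=> kc f al le; apply: avg_in_ext (avg_inZ kc (f _ le)) => s.
by rewrite mulrCA.
Qed.

Lemma fam1_ext Phi Phi' e : Phi =1 Phi' -> fam1 Phi e -> fam1 Phi' e.
Proof. by move=> h f al /f; apply: avg_in_ext => s; rewrite h. Qed.

Lemma fam10 e : fam1 (fun=> 0) e.
Proof. by move=> al _; apply: avg_in_ext avg_in0 => s; rewrite mulr0. Qed.

Lemma fam1W Phi e e' : (e <= e')%N -> fam1 Phi e -> fam1 Phi e'.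
Proof. by move=> ee f al le; apply: f; lia. Qed.

Lemma fam1_ps1 Phi e e' : (e < e')%N -> fam1 Phi e -> fam1 (fun s => ps X 1 * Phi s) e'.
Proof.
move=> ee f al le; have h : (al.+1 + e <= n)%N by lia.
by apply: avg_in_ext (f _ h) => s; rewrite exprSr mulrA.
Qed.

Lemma fam2D Phi Psi e : fam2 Phi e -> fam2 Psi e -> fam2 (fun s => Phi s + Psi s) e.
Proof.
move=> f g al le; apply: avg_in_ext (avg_inD (f _ le) (g _ le)) => s.
by rewrite mulrDr.
Qed.

Lemma fam2Z k Phi e : is_cst k -> fam2 Phi e -> fam2 (fun s => k * Phi s) e.
Proof.
move=> kc f al le; apply: avg_in_ext (avg_inZ kc (f _ le)) => s.
by rewrite mulrCA.
Qed.

Lemma fam2_ext Phi Phi' e : Phi =1 Phi' -> fam2 Phi e -> fam2 Phi' e.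
Proof. by move=> h f al /f; apply: avg_in_ext => s; rewrite h. Qed.

Lemma fam20 e : fam2 (fun=> 0) e.
Proof. by move=> al _; apply: avg_in_ext avg_in0 => s; rewrite mulr0. Qed.

Lemma fam2_tN Phi e e' : (N + e <= e')%N -> fam2 Phi e -> fam2 (fun s => tN X * Phi s) e'.
Proof.
move=> ee f al le; have h : (N * al.+1 + e <= n)%N by rewrite mulnS; lia.
by apply: avg_in_ext (f _ h) => s; rewrite exprSr mulrA.
Qed.

Variables (A c1 c2 c3 c4 : F).
Hypotheses (Ac : is_cst A) (k1 : is_cst c1) (k2 : is_cst c2) (k3 : is_cst c3) (k4 : is_cst c4).

(** T_0 Phi and J^- Phi have degrees e - 2 and e - 1, but being families of degree e is enough: the
    spaces only bound the degree from above, so the slack is harmless. *)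
Lemma step0 Phi e :
  (forall s, J0 X (Phi s) = e%:R * Phi s) ->
  fam0 Phi e -> fam0 (fun s => top X 0 A (Phi s)) e -> fam0 (fun s => Jm X (Phi s)) e ->
  forall al be, (al + 2 * be + e <= n)%N ->
  avg_in (fun s => ham X 0 A c1 0 c3 c4 (ps X 1 ^+ al * ps X 2 ^+ be * Phi s)).
Proof.
move=> eP fP fT fJ al be le; apply: avg_in_ham => //.
- apply: (avg_in_ext (fun s => esym (top0_step A al be (eP s)))).
  apply: avg_inD; last by apply: avg_inZ;
    [rewrite /top0_k2; prove_cst | apply: (fP al.-2 be); lia].
  apply: avg_inD; last by apply: avg_inZ;
    [rewrite /top0_k1; prove_cst | apply: (fP al be.-1); lia].
  apply: avg_inD; first exact: fT.
  by apply: avg_inZ; [prove_cst | apply: (fJ al.-1 be); lia].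
- by apply: avg_in_ext avg_in0 => s; rewrite mul0r.
- apply: (avg_in_ext (fun s => esym (J0_step0 al be (eP s)))).
  by apply: avg_inZ; [prove_cst | apply: fP].
- exact: fP.
Qed.

Lemma step1 Phi e :
  (forall s, J0 X (Phi s) = e%:R * Phi s) ->
  fam1 Phi e -> fam1 (fun s => top X 1 A (Phi s)) e -> fam1 (fun s => Jm X (Phi s)) e ->
  forall al, (al + e <= n)%N ->
  avg_in (fun s => ham X 1 A c1 c2 c3 c4 (ps X 1 ^+ al * Phi s)).
Proof.
move=> eP fP fT fJ al le; apply: avg_in_ham => //.
- apply: (avg_in_ext (fun s => esym (top1_step A al (eP s)))).
  apply: avg_inD; first exact: fT.
  by apply: avg_inZ; [rewrite /top1_k; prove_cst | apply: (fP al.-1); lia].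
- apply: avg_inZ => //; apply: (avg_in_ext (fun s => esym (Jm_step1 X al (Phi s)))).
  apply: avg_inD; first exact: fJ.
  by apply: avg_inZ; [prove_cst | apply: (fP al.-1); lia].
- apply: (avg_in_ext (fun s => esym (J0_step1 al (eP s)))).
  by apply: avg_inZ; [prove_cst | apply: fP].
- exact: fP.
Qed.

(** The Euler eigenvalue w is kept apart from the degree e because the degree N.-1 is a
    natural-number predecessor while the eigenvalue reads N%:R - 1. *)
Lemma step2 Phi e (w : F) : is_cst w ->
  (forall s, J0 X (Phi s) = w * Phi s) ->
  fam2 Phi e -> fam2 (fun s => top X 2 A (Phi s)) e ->
  forall al, (N * al + e <= n)%N ->
  avg_in (fun s => ham X 2 A c1 0 c3 c4 (tN X ^+ al * Phi s)).
Proof.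
move=> wc eP fP fT al le; apply: avg_in_ham => //.
- apply: (avg_in_ext (fun s => esym (top2_step A al (eP s)))).
  apply: avg_inD; first exact: fT.
  by apply: avg_inZ; [rewrite /top2_k; prove_cst | apply: fP].
- by apply: avg_in_ext avg_in0 => s; rewrite mul0r.
- apply: (avg_in_ext (fun s => esym (J0_step2 al (eP s)))).
  by apply: avg_inZ; [prove_cst | apply: fP].
- exact: fP.
Qed.

End Families.

(** * Generators with monomial coefficients *)

Section MonomialGenerators.
Variables (R : realType) (N : nat).
Local Notation C := R[i].

Definition mm2 a b : 'X_{1..2} := [multinom tnth [tuple a; b] i | i < 2].
Definition mm3 a b c : 'X_{1..3} := [multinom tnth [tuple a; b; c] i | i < 3].

Lemma wdeg2 (w0 w1 : nat) m : wdeg (tnth [tuple w0; w1]) m =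
  (w0 * m (@Ordinal 2 0 isT) + w1 * m (@Ordinal 2 1 isT))%N.
Proof.
rewrite /wdeg !big_ord_recl big_ord0 addn0.
by congr (_ * m _ + _ * m _)%N; apply: val_inj.
Qed.

Lemma wdeg3 (w0 w1 w2 : nat) m : wdeg (tnth [tuple w0; w1; w2]) m =
  (w0 * m (@Ordinal 3 0 isT) + w1 * m (@Ordinal 3 1 isT) + w2 * m (@Ordinal 3 2 isT))%N.
Proof.
rewrite /wdeg !big_ord_recl big_ord0 addn0 addnA.
by congr (_ * m _ + _ * m _ + _ * m _)%N; apply: val_inj.
Qed.

Lemma pol_comp2 (p q : {mpoly C[N]}) m : pol ('X_[m] \mPo [tuple p; q]) =
  pol p ^+ m (@Ordinal 2 0 isT) * pol q ^+ m (@Ordinal 2 1 isT).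
Proof.
rewrite comp_mpolyX !big_ord_recl big_ord0 mulr1 polM 2!polX.
by congr (_ ^+ m _ * _ ^+ m _); apply: val_inj.
Qed.

Lemma pol_comp3 (p q r : {mpoly C[N]}) m : pol ('X_[m] \mPo [tuple p; q; r]) =
  pol p ^+ m (@Ordinal 3 0 isT) * pol q ^+ m (@Ordinal 3 1 isT)
  * pol r ^+ m (@Ordinal 3 2 isT).
Proof.
rewrite comp_mpolyX !big_ord_recl big_ord0 mulr1 2!polM 3!polX mulrA.
by congr (_ ^+ m _ * _ ^+ m _ * _ ^+ m _); apply: val_inj.
Qed.

Lemma mm2E0 a b : mm2 a b (@Ordinal 2 0 isT) = a. Proof. by rewrite mnmE. Qed.
Lemma mm2E1 a b : mm2 a b (@Ordinal 2 1 isT) = b. Proof. by rewrite mnmE. Qed.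
Lemma mm3E0 a b c : mm3 a b c (@Ordinal 3 0 isT) = a. Proof. by rewrite mnmE. Qed.
Lemma mm3E1 a b c : mm3 a b c (@Ordinal 3 1 isT) = b. Proof. by rewrite mnmE. Qed.
Lemma mm3E2 a b c : mm3 a b c (@Ordinal 3 2 isT) = c. Proof. by rewrite mnmE. Qed.
Definition mmE := (mm2E0, mm2E1, mm3E0, mm3E1, mm3E2).

Lemma tuple2_homog (p q : {mpoly C[N]}) w0 w1 :
  p \is w0.-homog -> q \is w1.-homog ->
  forall i, tnth [tuple p; q] i \is (tnth [tuple w0; w1] i).-homog.
Proof. by move=> hp hq [[|[|//]] h]. Qed.

Lemma tuple3_homog (p q r : {mpoly C[N]}) w0 w1 w2 :
  p \is w0.-homog -> q \is w1.-homog -> r \is w2.-homog ->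
  forall i, tnth [tuple p; q; r] i \is (tnth [tuple w0; w1; w2] i).-homog.
Proof. by move=> hp hq hr [[|[|[|//]]] h]. Qed.

Lemma sigma_homog k : sigma R N k \is k.-homog.
Proof.
apply: rpred_sum => i _.
have x1 : ('X_i : {mpoly C[N]}) \is 1.-homog by rewrite dhomogX /= mdeg1.
by have := dhomogMn k x1; rewrite mul1n.
Qed.

Lemma tau_homog k : tau R N k \is k.-homog.
Proof. exact: dhomog_mesym. Qed.

Lemma deg_le_mono k (t : k.-tuple {mpoly C[N]}) (w : 'I_k -> nat) m (d : int) :
  (forall i, tnth t i \is (w i).-homog) -> (wdeg w m)%:Z <= d ->
  deg_le ('X_[m] \mPo t) d.
Proof.
move=> th md; rewrite /deg_le.
apply: (@le_trans _ _ (wdeg w m).+1%:Z); last by lia.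
exact: (dhomog_msize_le (comp_mono_homog th m)).
Qed.

End MonomialGenerators.

(** * The families available for epsilon = 0 *)

Section EpsilonZero.
Variables (R : realType) (N : nat) (hN : (2 < N)%N) (twoM n : nat).
Local Notation C := R[i].
Local Notation F := {fraction {mpoly C[N]}}.
Local Notation spins := (spinspace R N twoM).
Local Notation X := (frac_calculus R hN).
Local Notation p1 := (pos1 hN).
Local Notation p2 := (pos2 hN).
Local Notation z := (zvar X).
Local Notation H0 := (@H0space R N hN twoM n).
Local Notation fam := (@fam0 R N hN twoM n H0).

Lemma pos_neq (s : 'S_N) : s p1 != s p2.
Proof. by apply/eqP => /perm_inj /(congr1 val). Qed.

Lemma H0_lin : lin_closed H0.
Proof. exact: cspan_closed. Qed.

Lemma homog123 : forall i,
  tnth [tuple sigma R N 1; sigma R N 2; sigma R N 3] i \is (tnth [tuple 1; 2; 3]%N i).-homog.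
Proof. by apply: tuple3_homog; apply: sigma_homog. Qed.

Lemma homog12 : forall i,
  tnth [tuple sigma R N 1; sigma R N 2] i \is (tnth [tuple 1; 2]%N i).-homog.
Proof. by apply: tuple2_homog; apply: sigma_homog. Qed.

Lemma H0_f v al be ga : (ga <= 1)%N -> (al + 2 * be + 3 * ga <= n)%N ->
  avg_in H0 v (fun s => ps X 1 ^+ al * ps X 2 ^+ be * ps X 3 ^+ ga).
Proof.
move=> g1 le; have := @T0_f R N hN twoM n 'X_[mm3 al be ga] v.
rewrite /= pol_comp3 !mmE !(pol_sigma _ hN) Lambda_ket avgZ => h.
apply: (avg_in_ext (M := fun s => ps X 1 ^+ al * ps X 2 ^+ be * ps X 3 ^+ ga * 1)) => [s|].
  by rewrite mulr1.
apply/cspan_gen/h; first by apply: mderiv2X_eq0; rewrite mmE.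
by apply: deg_le_mono homog123 _; rewrite wdeg3 !mmE; lia.
Qed.

Lemma H0_g v al be ga : (ga <= 1)%N -> (al + 2 * be + 3 * ga + 1 <= n)%N ->
  avg_in H0 v (fun s => ps X 1 ^+ al * ps X 2 ^+ be * ps X 3 ^+ ga * z (s p1)).
Proof.
move=> g1 le; have := @T0_g R N hN twoM n 'X_[mm3 al be ga] v.
rewrite /= pol_comp3 !mmE !(pol_sigma _ hN) Lambda_avg avgZ => h.
apply: (avg_in_ext (M := fun s => ps X 1 ^+ al * ps X 2 ^+ be * ps X 3 ^+ ga *
  fperm s (zcoord R p1))) => [s|]; first by rewrite fperm_z.
apply/cspan_gen/h; first by apply: mderiv2X_eq0; rewrite mmE.
by apply: deg_le_mono homog123 _; rewrite wdeg3 !mmE; lia.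
Qed.

Lemma H0_h v al be : (al + 2 * be + 2 <= n)%N ->
  avg_in H0 v (fun s => ps X 1 ^+ al * ps X 2 ^+ be * z (s p1) ^+ 2).
Proof.
move=> le; have := @T0_h R N hN twoM n 'X_[mm2 al be] v.
rewrite /= pol_comp2 !mmE !(pol_sigma _ hN) Lambda_avg avgZ => h.
apply: (avg_in_ext (M := fun s => ps X 1 ^+ al * ps X 2 ^+ be *
  fperm s (zcoord R p1 ^+ 2))) => [s|]; first by rewrite rmorphXn /= fperm_z.
apply/cspan_gen/h.
by apply: deg_le_mono homog12 _; rewrite wdeg2 !mmE; lia.
Qed.

Lemma H0_ht v al be : in_Sigma' hN v -> (al + 2 * be + 2 <= n)%N ->
  avg_in H0 v (fun s => ps X 1 ^+ al * ps X 2 ^+ be * (z (s p1) * z (s p2))).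
Proof.
move=> vS le; have := @T0_ht R N hN twoM n 'X_[mm2 al be] v.
rewrite /= pol_comp2 !mmE !(pol_sigma _ hN) Lambda_avg avgZ => h.
apply: (avg_in_ext (M := fun s => ps X 1 ^+ al * ps X 2 ^+ be *
  fperm s (zcoord R p1 * zcoord R p2))) => [s|]; first by rewrite rmorphM /= !fperm_z.
apply/cspan_gen/h => //.
by apply: deg_le_mono homog12 _; rewrite wdeg2 !mmE; lia.
Qed.

Lemma H0_w v al be : (al + 2 * be + 3 <= n)%N ->
  avg_in H0 v (fun s => ps X 1 ^+ al * ps X 2 ^+ be *
    (z (s p1) * z (s p2) * (z (s p1) - z (s p2)))).
Proof.
move=> le; have := @T0_w R N hN twoM n 'X_[mm2 al be] v.
rewrite /= pol_comp2 !mmE !(pol_sigma _ hN) Lambda_avg avgZ => h.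
apply: (avg_in_ext (M := fun s => ps X 1 ^+ al * ps X 2 ^+ be *
  fperm s (zcoord R p1 * zcoord R p2 * (zcoord R p1 - zcoord R p2)))) => [s|].
  by rewrite 2!rmorphM rmorphB /= !fperm_z.
apply/cspan_gen/h.
by apply: deg_le_mono homog12 _; rewrite wdeg2 !mmE; lia.
Qed.

Lemma fam_1 v : fam v (fun=> 1) 0.
Proof.
move=> al be le; have := @H0_f v al be 0 isT; rewrite muln0 => /(_ le).
exact: avg_in_ext.
Qed.

Lemma fam_s3 v : fam v (fun=> ps X 3) 3.
Proof.
move=> al be le; have := @H0_f v al be 1 isT; rewrite muln1 => /(_ le).
exact: avg_in_ext.
Qed.

Lemma fam_z v : fam v (fun s => z (s p1)) 1.
Proof.
move=> al be le; have := @H0_g v al be 0 isT; rewrite muln0 addn0 => /(_ le).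
by apply: avg_in_ext => s; rewrite expr0 mulr1.
Qed.

Lemma fam_s3z v : fam v (fun s => ps X 3 * z (s p1)) 4.
Proof.
move=> al be le; have := @H0_g v al be 1 isT.
rewrite muln1 -addnA => /(_ le); apply: avg_in_ext => s; by rewrite expr1 -mulrA.
Qed.

Lemma fam_z2 v : fam v (fun s => z (s p1) ^+ 2) 2.
Proof. by move=> al be le; apply: H0_h. Qed.

(** The generators provide z_1 and z_1^2 only, while J^- of z_1 z_2 and of z_1 z_2 (z_1 - z_2) also
    yields z_2 and z_2^2. Exchanging the first two spins before averaging moves f to the second
    position; as this changes the spin vector, the hypothesis must hold for all v. *)
Lemma swap_positions (f : 'I_N -> F) e :
  (forall v, fam v (fun s => f (s p1)) e) -> forall v, fam v (fun s => f (s p2)) e.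
Proof.
move=> h v al be le; have := h (spin_act (tperm p1 p2) v) al be le.
rewrite /avg_in avg_spin_act tpermV.
by congr (H0 _); apply: avg_ext => s; rewrite permM tpermL.
Qed.

(** The permutations in |s^+_(i,i+1)> are those placing positions 1, 2 on the ordered pair (i, i+1),
    and the factor 1 + S_12 supplies the opposite orientation. Summing over i leaves the single
    condition that s(1) and s(2) are cyclic neighbours. *)
Lemma avg_adjacent (v : spins) :
  avg (fun s => (ordS (s p1) == s p2)%:R + (ordS (s p2) == s p1)%:R) v =
  ket (\sum_i splus hN i (ordS i) v).
Proof.
apply/ffunP => c; rewrite !ffunE sum_ffunE.
under [in RHS]eq_bigr => i _ do rewrite !ffunE sum_ffunE -[_ *: _]/(_ * _).
rewrite -mulr_sumr.
rewrite (exchange_big_dep xpredT) //=.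
(* Both sides are brought to one sum over the s with s(2) next after s(1). On the left the opposite
   orientation is reindexed by the transposition of the first two positions. *)
transitivity (cst N ((N`!%:R)^-1 * \sum_(s : 'S_N | ordS (s p1) == s p2)
   ((v [ffun k => c (s k)] : C) + (v [ffun k => c ((tperm p1 p2 * s)%g k)] : C)))).
  rewrite big_split /= mulrDr cstD.
  rewrite [X in _ = _ + cst N (_ * X)](reindex_inj (mulgI (tperm p1 p2))) /=.
  rewrite [X in _ = _ + cst N (_ * X)]
    (eq_bigl (fun s : 'S_N => ordS (s p2) == s p1)); last first.
    by move=> s; rewrite !permM tpermL tpermR.
  under [X in _ = _ + cst N (_ * X)]eq_bigr => s _ do rewrite mulgA tperm2 mul1g.
  rewrite !mulr_sumr !cst_sum.
  under eq_bigr do rewrite mulrDr.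
  rewrite big_split /=; congr (_ + _); rewrite [RHS]big_mkcond; apply: eq_bigr => s _;
    by case: ifP => _; rewrite ?mulr1 ?mulr0.
congr (cst N (_ * _)); rewrite [LHS]big_mkcond; apply: eq_bigr => s _.
(* For fixed s only i = s(1) can satisfy the constraint of [splus], so the sum over i has at most
   one term. *)
rewrite (eq_bigl (fun i => (i == s p1) && (ordS (s p1) == s p2))); last first.
  by move=> i; rewrite eq_sym [s p2 == _]eq_sym; case: eqVneq => // ->.
case: ifP => ad; last by rewrite big_pred0 // => i; rewrite andbF.
rewrite (eq_bigl (pred1 (s p1))); last by move=> i; rewrite andbT.
rewrite big_pred1_eq !ffunE; congr (v _ + v _); apply/ffunP => k; rewrite !ffunE //.
by rewrite permM.
Qed.

(** The neighbour state equals [Lambda] of another spin vector t, and its products with monomials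
    are then generators of the first kind, taken at t instead of v. *)
Lemma fam_adjacent v : in_Sigma' hN v ->
  fam v (fun s => (ordS (s p1) == s p2)%:R + (ordS (s p2) == s p1)%:R) 0.
Proof.
case=> t vt al be le; rewrite /avg_in -avgZ avg_adjacent vt Lambda_ket avgZ.
exact: (@fam_1 t al be le).
Qed.

End EpsilonZero.

(** * Invariance *)

Section HamiltonianZero.
Variables (R : realType) (N : nat) (hN : (2 < N)%N) (twoM n : nat) (a omega : R).
Local Notation C := R[i].
Local Notation F := {fraction {mpoly C[N]}}.
Local Notation spins := (spinspace R N twoM).
Local Notation X := (frac_calculus R hN).
Local Notation p1 := (pos1 hN).
Local Notation p2 := (pos2 hN).
Local Notation z := (zvar X).
Local Notation H0 := (@H0space R N hN twoM n).
Local Notation fam := (@fam0 R N hN twoM n H0).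
Local Notation A := (rcst N (2 * a)).
Local Notation Hbar := (@Hbar0 R N a omega).

Lemma Hbar0E x : Hbar x = ham X 0 A (-1) 0 (rcst N (2 * omega))
  (rcst N (N%:R * omega * (2 * a + 1))) x.
Proof. by rewrite /Hbar0 (TopE hN) (JzeroE hN) /ham mulN1r mul0r addr0. Qed.

Lemma Hbar0D x y : Hbar (x + y) = Hbar x + Hbar y.
Proof. by rewrite !Hbar0E hamD. Qed.

Lemma Hbar0Z c x : Hbar (cst N c * x) = cst N c * Hbar x.
Proof. by rewrite !Hbar0E hamMc //; apply: isconst_cst. Qed.

Definition stable0 v (Phi : 'S_N -> F) e := forall al be, (al + 2 * be + e <= n)%N ->
  avg_in H0 v (fun s => Hbar (ps X 1 ^+ al * ps X 2 ^+ be * Phi s)).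

Lemma stable0_step v Phi e :
  (forall s, J0 X (Phi s) = e%:R * Phi s) ->
  fam v Phi e -> fam v (fun s => top X 0 A (Phi s)) e -> fam v (fun s => Jm X (Phi s)) e ->
  stable0 v Phi e.
Proof.
move=> eP fP fT fJ al be le; apply: (avg_in_ext (fun s => esym (Hbar0E _))).
by apply: step0 eP fP fT fJ al be le; try prove_cst; exact: H0_lin.
Qed.

Local Notation fz2 := (swap_positions (f := z) (fam_z hN (n := n))).
Local Notation fz22 := (swap_positions (f := fun i => z i ^+ 2) (fam_z2 hN (n := n))).
Let L := @H0_lin R N hN twoM n.

Lemma stable0_1 v : stable0 v (fun=> 1) 0.
Proof.
apply: stable0_step; first by move=> s; rewrite J0_1 mul0r.
- exact: fam_1.
- by apply: (fam0_ext _ (@fam00 R N hN twoM n H0 L v _)) => s; rewrite top1.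
- by apply: (fam0_ext _ (@fam00 R N hN twoM n H0 L v _)) => s; rewrite Jm_1.
Qed.

Lemma stable0_s3 v : stable0 v (fun=> ps X 3) 3.
Proof.
apply: stable0_step; first by move=> s; rewrite J0_ps.
- exact: fam_s3.
- apply: (fam0_ext (fun=> esym (top0_ps3 X A))).
  apply: (fam0_ext (Phi := fun=> 6 * (1 + A) * (ps X 1 * 1))) => [s|];
    first by rewrite mulr1.
  by apply: fam0Z => //; [prove_cst | apply: (fam0_ps1 _ (fam_1 _ _))].
- apply: (fam0_ext (Phi := fun=> 3 * (ps X 2 * 1))) => [s|]; first by rewrite mulr1 Jm_ps.
  by apply: fam0Z => //; [prove_cst | apply: (fam0_ps2 _ (fam_1 _ _))].
Qed.

Lemma stable0_z v : stable0 v (fun s => z (s p1)) 1.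
Proof.
apply: stable0_step; first by move=> s; rewrite J0_z mul1r.
- exact: fam_z.
- by apply: (fam0_ext _ (@fam00 R N hN twoM n H0 L v _)) => s; rewrite top0_z.
- by apply: (fam0_ext _ (fam0W _ (fam_1 hN v))) => // s; rewrite Jm_z.
Qed.

(** The term Gamma(sigma_3, z_k) = 3 z_k^2 is where the generators with z_1^2 become necessary. *)
Lemma stable0_s3z v : stable0 v (fun s => ps X 3 * z (s p1)) 4.
Proof.
apply: stable0_step; first by move=> s; rewrite J0_ps3z.
- exact: fam_s3z.
- apply: (fam0_ext (fun s => esym (top0_ps3z X A (s p1)))).
  apply: fam0D => //; apply: fam0Z => //; try prove_cst.
    by apply: (fam0_ps1 _ (fam_z _ _)).
  by apply: (fam0W _ (fam_z2 _ _)).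
- apply: (fam0_ext (fun s => esym (Jm_ps3z X (s p1)))).
  apply: fam0D => //; last by apply: (fam0W _ (fam_s3 _ _)).
  by apply: fam0Z => //; [prove_cst | apply: (fam0_ps2 _ (fam_z _ _))].
Qed.

Lemma stable0_z2 v : stable0 v (fun s => z (s p1) ^+ 2) 2.
Proof.
apply: stable0_step; first by move=> s; rewrite J0_z2.
- exact: fam_z2.
- apply: (fam0_ext (Phi := fun=> (2 + 2 * A) * 1)) => [s|]; first by rewrite mulr1 top0_z2.
  by apply: fam0Z => //; [prove_cst | apply: (fam0W _ (fam_1 _ _))].
- apply: (fam0_ext (fun s => esym (Jm_z2 X (s p1)))).
  by apply: fam0Z => //; [prove_cst | apply: (fam0W _ (fam_z _ _))].
Qed.

Lemma stable0_zz v : in_Sigma' hN v -> stable0 v (fun s => z (s p1) * z (s p2)) 2.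
Proof.
move=> vS; apply: stable0_step; first by move=> s; rewrite J0_zz.
- by move=> al be; apply: H0_ht.
- apply: (fam0_ext (fun s => esym (top0_zz X A (pos_neq hN s)))).
  by apply: fam0Z => //; [prove_cst | apply: (fam0W _ (fam_adjacent vS))].
- apply: (fam0_ext (fun s => esym (Jm_zz X (s p1) (s p2)))).
  by apply: fam0D => //; [apply: (fam0W _ (fam_z _ _)) | apply: (fam0W _ (fz2 v))].
Qed.

Lemma stable0_w v :
  stable0 v (fun s => z (s p1) * z (s p2) * (z (s p1) - z (s p2))) 3.
Proof.
apply: stable0_step; first by move=> s; rewrite J0_w.
- by move=> al be; apply: H0_w.
- apply: (fam0_ext (fun s => esym (top0_w X A (pos_neq hN s)))).
  apply: fam0Z => //; first by prove_cst.
  apply: (fam0_ext (Phi := fun s => z (s p2) + -1 * z (s p1))) => [s|];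
    first by rewrite mulN1r.
  apply: fam0D => //; first by apply: (fam0W _ (fz2 v)).
  by apply: fam0Z => //; [prove_cst | apply: (fam0W _ (fam_z _ _))].
- apply: (fam0_ext (fun s => esym (Jm_w X (s p1) (s p2)))).
  apply: fam0D => //; first by apply: (fam0W _ (fam_z2 _ _)).
  by apply: fam0Z => //; [prove_cst | apply: (fam0W _ (fz22 v))].
Qed.

Lemma H0_invariant : leaves_invariant (on_states Hbar) H0.
Proof.
have SL := lin_closed_on_states Hbar0D Hbar0Z L.
move=> psi; apply: (cspan_min SL) => y.
case=> [f v p fc pd|g v p gc pd|h v p pd|ht v p vS pd|w v p pd];
  (apply: (comp_mpoly_ind SL _ pd); [exact: homog123 || exact: homog12 | move=> m mf]);
  rewrite ?wdeg2 ?wdeg3 ?pol_comp2 ?pol_comp3 !(pol_sigma _ hN) ?Lambda_ket ?Lambda_avg avgZ;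
  rewrite (on_states_avg _ _ Hbar0D Hbar0Z) => md.
(* Since f_33 = 0 the exponent of sigma_3 is 0 or 1, which selects Phi = 1 or Phi = sigma_3; the
   second bullet does the same with an extra factor z_1. *)
- have := mderiv2_eq0 fc mf; rewrite -/(avg_in H0 v _); move: md.
  case: (m (@Ordinal 3 2 isT)) => [|[|//]] md _.
    by apply: avg_in_ext (stable0_1 v (al := m _) (be := m _) _) => [s|];
      [by rewrite expr0 mulr1 | lia].
  by apply: avg_in_ext (stable0_s3 v (al := m _) (be := m _) _) => [s|];
    [by rewrite expr1 mulr1 | lia].
- have := mderiv2_eq0 gc mf; rewrite -/(avg_in H0 v _); move: md.
  case: (m (@Ordinal 3 2 isT)) => [|[|//]] md _.
    by apply: avg_in_ext (stable0_z v (al := m _) (be := m _) _) => [s|];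
      [by rewrite expr0 mulr1 fperm_z | lia].
  by apply: avg_in_ext (stable0_s3z v (al := m _) (be := m _) _) => [s|];
    [by rewrite mulrA expr1 fperm_z | lia].
- by apply: avg_in_ext (stable0_z2 v (al := m _) (be := m _) _) => [s|];
    [by rewrite rmorphXn /= fperm_z | lia].
- by apply: avg_in_ext (stable0_zz vS (al := m _) (be := m _) _) => [s|];
    [by rewrite rmorphM /= !fperm_z | lia].
- by apply: avg_in_ext (stable0_w v (al := m _) (be := m _) _) => [s|];
    [by rewrite 2!rmorphM rmorphB /= !fperm_z | lia].
Qed.

End HamiltonianZero.

(** * The case epsilon = 1 *)

Section HamiltonianOne.
Variables (R : realType) (N : nat) (hN : (2 < N)%N) (twoM n : nat) (a b omega : R).
Local Notation C := R[i].
Local Notation F := {fraction {mpoly C[N]}}.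
Local Notation spins := (spinspace R N twoM).
Local Notation X := (frac_calculus R hN).
Local Notation p1 := (pos1 hN).
Local Notation z := (zvar X).
Local Notation H1 := (@H1space R N hN twoM n).
Local Notation fam := (@fam1 R N hN twoM n H1).
Local Notation A := (rcst N (2 * a)).
Local Notation Hbar := (@Hbar1 R N a b omega).

Lemma Hbar1E x : Hbar x = ham X 1 A (- rcst N 4) (- rcst N (2 * (2 * b + 1)))
  (rcst N (4 * omega)) (rcst N (N%:R * omega * (4 * a + 2 * b + 1))) x.
Proof. by rewrite /Hbar1 (TopE hN) (JzeroE hN) (JminusE hN) /ham 2!mulNr. Qed.

Lemma Hbar1D x y : Hbar (x + y) = Hbar x + Hbar y.
Proof. by rewrite !Hbar1E hamD. Qed.

Lemma Hbar1Z c x : Hbar (cst N c * x) = cst N c * Hbar x.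
Proof. by rewrite !Hbar1E hamMc //; apply: isconst_cst. Qed.

Lemma H1_lin : lin_closed H1.
Proof. exact: cspan_closed. Qed.
Let L := H1_lin.

Lemma homog12N : forall i, tnth [tuple sigma R N 1; sigma R N 2; tau R N N] i
  \is (tnth [tuple 1; 2; N]%N i).-homog.
Proof. by apply: tuple3_homog; [apply: sigma_homog | apply: sigma_homog | apply: tau_homog]. Qed.

Lemma homog1N : forall i,
  tnth [tuple sigma R N 1; tau R N N] i \is (tnth [tuple 1; N]%N i).-homog.
Proof. by apply: tuple2_homog; [apply: sigma_homog | apply: tau_homog]. Qed.

Lemma H1_f v al be : (be <= 1)%N -> (al + 2 * be <= n)%N ->
  avg_in H1 v (fun=> ps X 1 ^+ al * ps X 2 ^+ be).
Proof.
move=> g1 le; have := @T1_f R N hN twoM n 'X_[mm3 al be 0] v.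
rewrite /= pol_comp3 !mmE !(pol_sigma _ hN) Lambda_ket avgZ expr0 => h.
apply: (avg_in_ext (M := fun s => ps X 1 ^+ al * ps X 2 ^+ be * 1 * 1)) => [s|].
  by rewrite !mulr1.
apply/cspan_gen/h.
- by apply: mderiv2X_eq0; rewrite mmE.
- by apply: mderiv2X_eq0; rewrite mmE.
- by apply: mderivX_eq0; rewrite mmE.
- by apply: deg_le_mono homog12N _; rewrite wdeg3 !mmE muln0; lia.
Qed.

Lemma H1_g v al : (al + 1 <= n)%N -> avg_in H1 v (fun s => ps X 1 ^+ al * z (s p1)).
Proof.
move=> le; have := @T1_g R N hN twoM n 'X_[mm2 al 0] v.
rewrite /= pol_comp2 !mmE !(pol_sigma _ hN) Lambda_avg avgZ expr0 mulr1 => h.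
apply: (avg_in_ext (M := fun s => ps X 1 ^+ al * fperm s (zcoord R p1))) => [s|].
  by rewrite fperm_z.
apply/cspan_gen/h.
- by apply: mderiv2X_eq0; rewrite mmE.
- by apply: mderivX_eq0; rewrite mmE.
- by apply: deg_le_mono homog1N _; rewrite wdeg2 !mmE muln0; lia.
Qed.

Lemma fam1_1 v : fam v (fun=> 1) 0.
Proof.
move=> al le; have := @H1_f v al 0 isT; rewrite muln0 => /(_ le).
exact: avg_in_ext.
Qed.

Lemma fam1_s2 v : fam v (fun=> ps X 2) 2.
Proof.
move=> al le; have := @H1_f v al 1 isT; rewrite muln1 => /(_ le).
exact: avg_in_ext.
Qed.

Lemma fam1_z v : fam v (fun s => z (s p1)) 1.
Proof. by move=> al; apply: H1_g. Qed.

Definition stable1 v (Phi : 'S_N -> F) e := forall al, (al + e <= n)%N ->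
  avg_in H1 v (fun s => Hbar (ps X 1 ^+ al * Phi s)).

Lemma stable1_step v Phi e :
  (forall s, J0 X (Phi s) = e%:R * Phi s) ->
  fam v Phi e -> fam v (fun s => top X 1 A (Phi s)) e -> fam v (fun s => Jm X (Phi s)) e ->
  stable1 v Phi e.
Proof.
move=> eP fP fT fJ al le; apply: (avg_in_ext (fun s => esym (Hbar1E _))).
by apply: step1 eP fP fT fJ al le; try prove_cst; exact: H1_lin.
Qed.

Local Notation f0 v := (@fam10 R N hN twoM n H1 L v _).

Lemma stable1_1 v : stable1 v (fun=> 1) 0.
Proof.
apply: stable1_step; first by move=> s; rewrite J0_1 mul0r.
- exact: fam1_1.
- by apply: (fam1_ext _ (f0 v)) => s; rewrite top1.
- by apply: (fam1_ext _ (f0 v)) => s; rewrite Jm_1.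
Qed.

Lemma stable1_s2 v : stable1 v (fun=> ps X 2) 2.
Proof.
apply: stable1_step; first by move=> s; rewrite J0_ps.
- exact: fam1_s2.
- apply: (fam1_ext (Phi := fun=> (2 + 4 * A) * (ps X 1 * 1))) => [s|].
    by rewrite mulr1 top1_ps2.
  by apply: fam1Z => //; [prove_cst | apply: (fam1_ps1 _ (fam1_1 _))].
- apply: (fam1_ext (Phi := fun=> 2 * (ps X 1 * 1))) => [s|]; first by rewrite mulr1 Jm_ps.
  by apply: fam1Z => //; [prove_cst | apply: (fam1_ps1 _ (fam1_1 _))].
Qed.

Lemma stable1_z v : stable1 v (fun s => z (s p1)) 1.
Proof.
apply: stable1_step; first by move=> s; rewrite J0_z mul1r.
- exact: fam1_z.
- apply: (fam1_ext (Phi := fun=> A * 1)) => [s|]; first by rewrite mulr1 top1_z.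
  by apply: fam1Z => //; [prove_cst | apply: (fam1W _ (fam1_1 _))].
- by apply: (fam1_ext _ (fam1W _ (fam1_1 v))) => // s; rewrite Jm_z.
Qed.

Lemma H1_invariant : leaves_invariant (on_states Hbar) H1.
Proof.
have SL := lin_closed_on_states Hbar1D Hbar1Z L.
move=> psi; apply: (cspan_min SL) => y.
case=> [f v p f2 _ fc pd|g v p _ gc pd];
  (apply: (comp_mpoly_ind SL _ pd); [exact: homog12N || exact: homog1N | move=> m mf]);
  rewrite ?wdeg2 ?wdeg3 ?pol_comp2 ?pol_comp3 !(pol_sigma _ hN) ?Lambda_ket ?Lambda_avg avgZ;
  rewrite (on_states_avg _ _ Hbar1D Hbar1Z) => md.
(* f_22 = 0 leaves the exponents 0 and 1 of sigma_2, and f_N = 0 removes tau_N altogether. *)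
- have := mderiv2_eq0 f2 mf; rewrite -/(avg_in H1 v _); move: md.
  rewrite (mderiv_eq0 fc mf) muln0 addn0.
  case: (m (@Ordinal 3 1 isT)) => [|[|//]] md _.
    by apply: avg_in_ext (stable1_1 v (al := m _) _) => [s|];
      [by rewrite !expr0 !mulr1 | lia].
  by apply: avg_in_ext (stable1_s2 v (al := m _) _) => [s|];
    [by rewrite expr0 !mulr1 | lia].
- rewrite -/(avg_in H1 v _); move: md; rewrite (mderiv_eq0 gc mf) muln0 addn0 => md.
  by apply: avg_in_ext (stable1_z v (al := m _) _) => [s|];
    [by rewrite expr0 mulr1 fperm_z | lia].
Qed.

End HamiltonianOne.

(** * The case epsilon = 2 *)

Section HamiltonianTwo.
Variables (R : realType) (N : nat) (hN : (2 < N)%N) (twoM n : nat) (a : R).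
Local Notation C := R[i].
Local Notation F := {fraction {mpoly C[N]}}.
Local Notation spins := (spinspace R N twoM).
Local Notation X := (frac_calculus R hN).
Local Notation p1 := (pos1 hN).
Local Notation z := (zvar X).
Local Notation H2 := (@H2space R N hN twoM n).
Local Notation fam := (@fam2 R N hN twoM n H2).
Local Notation A := (rcst N (2 * a)).
Local Notation Hbar := (@Hbar2 R N a).

Lemma Hbar2E x : Hbar x = ham X 2 A (rcst N 4) 0 (rcst N (4 * (1 - 2 * a)))
  (rcst N (2 * N%:R * a ^+ 2)) x.
Proof. by rewrite /Hbar2 (TopE hN) (JzeroE hN) /ham mul0r addr0. Qed.

Lemma Hbar2D x y : Hbar (x + y) = Hbar x + Hbar y.
Proof. by rewrite !Hbar2E hamD. Qed.

Lemma Hbar2Z c x : Hbar (cst N c * x) = cst N c * Hbar x.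
Proof. by rewrite !Hbar2E hamMc //; apply: isconst_cst. Qed.

Lemma H2_lin : lin_closed H2.
Proof. exact: cspan_closed. Qed.
Let L := H2_lin.

Lemma homog1NN : forall i, tnth [tuple sigma R N 1; tau R N N.-1; tau R N N] i
  \is (tnth [tuple 1; N.-1; N]%N i).-homog.
Proof. by apply: tuple3_homog; [apply: sigma_homog | apply: tau_homog | apply: tau_homog]. Qed.

Lemma homogNN : forall i,
  tnth [tuple tau R N N.-1; tau R N N] i \is (tnth [tuple N.-1; N]%N i).-homog.
Proof. by apply: tuple2_homog; apply: tau_homog. Qed.

Lemma H2_f v k l al : (k <= 1)%N -> (l <= 1)%N -> (k + N.-1 * l + N * al <= n)%N ->
  avg_in H2 v (fun=> tN X ^+ al * (ps X 1 ^+ k * tN1 X ^+ l)).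
Proof.
move=> k1 l1 le; have := @T2_f R N hN twoM n 'X_[mm3 k l al] v.
rewrite /= pol_comp3 !mmE (pol_sigma _ hN) (pol_tauN _ hN) (pol_tauN1 _ hN).
rewrite Lambda_ket avgZ => h.
apply: (avg_in_ext (M := fun s => ps X 1 ^+ k * tN1 X ^+ l * tN X ^+ al * 1)) => [s|].
  by rewrite mulr1 mulrC.
apply/cspan_gen/h.
- by apply: mderiv2X_eq0; rewrite mmE.
- by apply: mderiv2X_eq0; rewrite mmE.
- by apply: deg_le_mono homog1NN _; rewrite wdeg3 !mmE mul1n lez_nat.
Qed.

Lemma H2_g v l al : (l <= 1)%N -> (N.-1 * l + N * al + 1 <= n)%N ->
  avg_in H2 v (fun s => tN X ^+ al * (tN1 X ^+ l * z (s p1))).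
Proof.
move=> l1 le; have := @T2_g R N hN twoM n 'X_[mm2 l al] v.
rewrite /= pol_comp2 !mmE (pol_tauN _ hN) (pol_tauN1 _ hN) Lambda_avg avgZ => h.
apply: (avg_in_ext (M := fun s => tN1 X ^+ l * tN X ^+ al * fperm s (zcoord R p1))) => [s|].
  by rewrite fperm_z mulrAC mulrC.
apply/cspan_gen/h; first by apply: mderiv2X_eq0; rewrite mmE.
apply: deg_le_mono homogNN _; rewrite wdeg2 !mmE; lia.
Qed.

(** The bound deg q <= n - N + 1 is written with N moved to the other side, which avoids a truncated
    difference; tau_N / z_1 accounts for the missing N - 1 degrees. *)
Lemma H2_q v k al : (k <= 1)%N -> (N + k + N * al <= n.+1)%N ->
  avg_in H2 v (fun s => tN X ^+ al * (tN X * (ps X 1 ^+ k * (z (s p1))^-1))).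
Proof.
move=> k1 le; have := @T2_q R N hN twoM n 'X_[mm2 k al] v.
rewrite /= pol_comp2 !mmE (pol_tauN _ hN) (pol_sigma _ hN) Lambda_avg avgZ => h.
apply: (avg_in_ext (M := fun s => tN X * (ps X 1 ^+ k * tN X ^+ al) *
  fperm s (zcoord R p1)^-1)) => [s|].
  by rewrite fmorphV /= fperm_z [RHS]mulrCA -!mulrA; congr (_ * _); rewrite mulrCA.
apply/cspan_gen/h; first by apply: mderiv2X_eq0; rewrite mmE.
apply: deg_le_mono (homog1N R N) _; rewrite wdeg2 !mmE; lia.
Qed.

Lemma fam2_1 v : fam v (fun=> 1) 0.
Proof.
move=> al le; have := @H2_f v 0 0 al isT isT; rewrite muln0 add0n addn0 in le * => /(_ le).
by apply: avg_in_ext => s; rewrite !expr0 mulr1.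
Qed.

Lemma fam2_s1 v : fam v (fun=> ps X 1) 1.
Proof.
move=> al le; have h : (1 + N.-1 * 0 + N * al <= n)%N by lia.
by apply: avg_in_ext (@H2_f v 1 0 al isT isT h) => s; rewrite mulr1.
Qed.

Lemma fam2_tN1 v : fam v (fun=> tN1 X) N.-1.
Proof.
move=> al le; have h : (0 + N.-1 * 1 + N * al <= n)%N by lia.
by apply: avg_in_ext (@H2_f v 0 1 al isT isT h) => s; rewrite mul1r.
Qed.

Lemma fam2_s1tN1 v : fam v (fun=> ps X 1 * tN1 X) N.
Proof.
move=> al le; have h : (1 + N.-1 * 1 + N * al <= n)%N by have := hN; lia.
by apply: avg_in_ext (@H2_f v 1 1 al isT isT h).
Qed.

Lemma fam2_z v : fam v (fun s => z (s p1)) 1.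
Proof.
move=> al le; have h : (N.-1 * 0 + N * al + 1 <= n)%N by lia.
by apply: avg_in_ext (@H2_g v 0 al isT h) => s; rewrite mul1r.
Qed.

Lemma fam2_tN1z v : fam v (fun s => tN1 X * z (s p1)) N.
Proof.
move=> al le; have h : (N.-1 * 1 + N * al + 1 <= n)%N by have := hN; lia.
by apply: avg_in_ext (@H2_g v 1 al isT h).
Qed.

Lemma fam2_q v : fam v (fun s => tN X * (z (s p1))^-1) N.-1.
Proof.
move=> al le; have h : (N + 0 + N * al <= n.+1)%N by lia.
by apply: avg_in_ext (@H2_q v 0 al isT h) => s; rewrite mul1r.
Qed.

Lemma fam2_s1q v : fam v (fun s => tN X * (ps X 1 * (z (s p1))^-1)) N.
Proof.
move=> al le; have h : (N + 1 + N * al <= n.+1)%N by lia.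
by apply: avg_in_ext (@H2_q v 1 al isT h).
Qed.

(** Bare tau_N is the only new shape T_2 creates: it comes from Gamma(sigma_1, tau_(N-1)), from
    Gamma(tau_(N-1), z_k), and from tau_N Gamma(sigma_1, 1/z_k). It has the same degree N as the
    products that produce it. *)
Lemma fam2_tN_1 v : fam v (fun=> tN X) N.
Proof.
apply: (fam2_ext (Phi := fun=> tN X * 1)) => [s|]; first by rewrite mulr1.
by apply: (fam2_tN _ (fam2_1 _)); rewrite addn0.
Qed.

Definition stable2 v (Phi : 'S_N -> F) e := forall al, (N * al + e <= n)%N ->
  avg_in H2 v (fun s => Hbar (tN X ^+ al * Phi s)).

Lemma stable2_step v Phi e (w : F) : is_cst w ->
  (forall s, J0 X (Phi s) = w * Phi s) ->
  fam v Phi e -> fam v (fun s => top X 2 A (Phi s)) e -> stable2 v Phi e.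
Proof.
move=> wc eP fP fT al le; apply: (avg_in_ext (fun s => esym (Hbar2E _))).
by apply: step2 wc eP fP fT al le; try prove_cst; exact: H2_lin.
Qed.

Local Notation f0 v := (@fam20 R N hN twoM n H2 L v _).

Lemma stable2_1 v : stable2 v (fun=> 1) 0.
Proof.
apply: (stable2_step (w := 0%:R)); [prove_cst | by move=> s; rewrite J0_1 mul0r | | ].
- exact: fam2_1.
- by apply: (fam2_ext _ (f0 v)) => s; rewrite top1.
Qed.

Lemma stable2_s1 v : stable2 v (fun=> ps X 1) 1.
Proof.
apply: (stable2_step (w := 1%:R)); [prove_cst | by move=> s; rewrite J0_ps | | ].
- exact: fam2_s1.
- apply: (fam2_ext (fun=> esym (top2_ps1 X A))).
  by apply: fam2Z (fam2_s1 v) => //; prove_cst.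
Qed.

Lemma stable2_tN1 v : stable2 v (fun=> tN1 X) N.-1.
Proof.
apply: (stable2_step (w := N%:R - 1)); [prove_cst | by move=> s; rewrite J0_tN1 | | ].
- exact: fam2_tN1.
- apply: (fam2_ext (fun=> esym (top2_tN1 X A))).
  by apply: fam2Z (fam2_tN1 v) => //; prove_cst.
Qed.

Lemma stable2_s1tN1 v : stable2 v (fun=> ps X 1 * tN1 X) N.
Proof.
apply: (stable2_step (w := N%:R)); [prove_cst | by move=> s; rewrite J0_ps1tN1 | | ].
- exact: fam2_s1tN1.
- apply: (fam2_ext (fun=> esym (top2_ps1tN1 X A))); rewrite -mulNr.
  by apply: fam2D => //; apply: fam2Z => //; try prove_cst; [exact: fam2_s1tN1 | exact: fam2_tN_1].
Qed.

Lemma stable2_z v : stable2 v (fun s => z (s p1)) 1.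
Proof.
apply: (stable2_step (w := 1%:R)); [prove_cst | by move=> s; rewrite J0_z mul1r | | ].
- exact: fam2_z.
- apply: (fam2_ext (fun s => esym (top2_z X A (s p1)))).
  by apply: fam2Z (fam2_z v) => //; prove_cst.
Qed.

Lemma stable2_tN1z v : stable2 v (fun s => tN1 X * z (s p1)) N.
Proof.
apply: (stable2_step (w := N%:R)); [prove_cst | by move=> s; rewrite J0_tN1z | | ].
- exact: fam2_tN1z.
- apply: (fam2_ext (Phi := fun s => (2 * A + A * N%:R + 2) * (tN1 X * z (s p1)
    ) + - 2 * tN X)) => [s|].
    by rewrite top2_tN1z mulNr.
  by apply: fam2D => //; apply: fam2Z => //; try prove_cst; [exact: fam2_tN1z | exact: fam2_tN_1].
Qed.

Lemma stable2_q v : stable2 v (fun s => tN X * (z (s p1))^-1) N.-1.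
Proof.
apply: (stable2_step (w := N%:R - 1)); [prove_cst | by move=> s; rewrite J0_tNVz | | ].
- exact: fam2_q.
- apply: (fam2_ext (fun s => esym (top2_tNVz X A (s p1)))).
  by apply: fam2Z (fam2_q v) => //; prove_cst.
Qed.

Lemma stable2_s1q v : stable2 v (fun s => tN X * (ps X 1 * (z (s p1))^-1)) N.
Proof.
apply: (stable2_step (w := N%:R)); [prove_cst | by move=> s; rewrite J0_tNps1Vz | | ].
- exact: fam2_s1q.
- apply: (fam2_ext (Phi := fun s =>
    (2 + 2 * A + A * N%:R) * (tN X * (ps X 1 * (z (s p1))^-1)) + - 2 * tN X)) => [s|].
    by rewrite top2_tNps1Vz mulNr.
  by apply: fam2D => //; apply: fam2Z => //; try prove_cst; [exact: fam2_s1q | exact: fam2_tN_1].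
Qed.

Lemma H2_invariant : leaves_invariant (on_states Hbar) H2.
Proof.
have SL := lin_closed_on_states Hbar2D Hbar2Z L.
move=> psi; apply: (cspan_min SL) => y.
case=> [f v p f1 f2 pd|g v p g1 pd|q v p q1 pd].
- apply: (comp_mpoly_ind SL homog1NN pd) => m mf.
  rewrite wdeg3 pol_comp3 (pol_sigma _ hN) (pol_tauN _ hN) (pol_tauN1 _ hN) Lambda_ket avgZ.
  rewrite (on_states_avg _ _ Hbar2D Hbar2Z) -/(avg_in H2 v _).
  have := mderiv2_eq0 f1 mf; have := mderiv2_eq0 f2 mf.
  (* The two linearity conditions leave four products of sigma_1 and tau_(N-1) as Phi, the power of
     tau_N staying free. *)
  case: (m (@Ordinal 3 0 isT)) => [|[|//]]; case: (m (@Ordinal 3 1 isT)) => [|[|//]] _ _ md.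
  + by apply: avg_in_ext (stable2_1 v (al := m _) _) => [s|];
      [by rewrite !expr0 !mul1r | lia].
  + by apply: avg_in_ext (stable2_tN1 v (al := m _) _) => [s|];
      [by rewrite expr0 expr1 mul1r mulr1 mulrC | lia].
  + by apply: avg_in_ext (stable2_s1 v (al := m _) _) => [s|];
      [by rewrite expr0 expr1 !mulr1 mulrC | lia].
  + by apply: avg_in_ext (stable2_s1tN1 v (al := m _) _) => [s|];
      [by rewrite !expr1 mulr1 mulrC | have := hN; lia].
- apply: (comp_mpoly_ind SL homogNN pd) => m mf.
  rewrite wdeg2 pol_comp2 (pol_tauN _ hN) (pol_tauN1 _ hN) Lambda_avg avgZ.
  rewrite (on_states_avg _ _ Hbar2D Hbar2Z) -/(avg_in H2 v _).
  have := mderiv2_eq0 g1 mf.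
  case: (m (@Ordinal 2 0 isT)) => [|[|//]] _ md.
  + by apply: avg_in_ext (stable2_z v (al := m _) _) => [s|];
      [by rewrite expr0 mul1r fperm_z | lia].
  + apply: avg_in_ext (stable2_tN1z v (al := m _) _) => [s|].
      by rewrite fperm_z expr1 mulrA [tN X ^+ _ * _]mulrC.
    by have := hN; lia.
(* The prefactor tau_N belongs to Phi rather than to q; it is moved onto the state so that the
   reduction to monomials, with the degree bound of q, concerns q alone. *)
- rewrite mulrC -scalerA; apply: (comp_mpoly_ind SL (homog1N R N) pd) => m mf.
  rewrite wdeg2 pol_comp2 (pol_tauN _ hN) (pol_sigma _ hN) Lambda_avg !avgZ.
  rewrite (on_states_avg _ _ Hbar2D Hbar2Z) -/(avg_in H2 v _).
  have := mderiv2_eq0 q1 mf.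
  case: (m (@Ordinal 2 0 isT)) => [|[|//]] _ md.
  + apply: avg_in_ext (stable2_q v (al := m _) _) => [s|];
      [by rewrite expr0 mul1r fmorphV /= fperm_z | lia].
  + apply: avg_in_ext (stable2_s1q v (al := m (@Ordinal 2 1 isT)) _) => [s|]; last by lia.
    rewrite fmorphV /= fperm_z expr1; congr (Hbar _).
    by rewrite [tN X * (_ * _)]mulrCA !mulrA [tN X ^+ _ * _]mulrC.
Qed.

End HamiltonianTwo.

Theorem corollary1 (R : realType) (N : nat) (hN : (2 < N)%N) (twoM : nat)
    (a b omega : R) (ha : 1 / 2 < a) (hb : 1 / 2 < b) (n : nat) :
  [/\ leaves_invariant (on_states (Hbar0 a omega)) (H0space hN (twoM:=twoM) n),
      leaves_invariant (on_states (Hbar1 a b omega)) (H1space hN (twoM:=twoM) n)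
    & leaves_invariant (on_states (Hbar2 a)) (H2space hN (twoM:=twoM) n)].
Proof.
split; [exact: H0_invariant | exact: H1_invariant | exact: H2_invariant].
Qed.
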